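(* For each real $\lambda\geq 1$ there exists $c=c(\lambda)>0$ such that every graph with average degree $d$ and maximum degree at most $\lambda d$ contains an $r$-regular subgraph for every positive integer $r\leq cd$.
   Context: All graphs are finite and simple with non-empty vertex sets. An $r$-regular subgraph is a subgraph (with non-empty vertex set) in which every vertex has degree exactly $r$. *)

(* Defs.v *)
From HB Require Import structures.
From mathcomp Require Import all_boot all_order all_algebra.
From mathcomp Require Import reals.

Set Implicit Arguments.
Unset Strict Implicit.
Unset Printing Implicit Defensive.

Import Order.TTheory GRing.Theory Num.Theory.

Record sgraph := SGraph {
  svertex :> finType;
  sedge : rel svertex;
  sedge_sym : symmetric sedge;
  sedge_irrefl : irreflexive sedge;
  svertex_gt0 : 0 < #|svertex|
}.

Definition degree (G : sgraph) (x : G) : nat := #|[set y : G | sedge x y]|.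

Definition max_degree (G : sgraph) : nat := \max_(x : G) degree x.

Definition average_degree (R : realType) (G : sgraph) : R :=
  ((\sum_(x : G) degree x)%N%:R / #|G|%:R)%R.

(* Not necessarily induced, nor spanning. *)
Record subgraph (G : sgraph) := Subgraph {
  sub_verts : {set G};
  sub_edge : rel G;
  sub_verts_neq0 : sub_verts != set0;
  sub_edge_sym : symmetric sub_edge;
  sub_edge_verts : forall x y, sub_edge x y -> x \in sub_verts /\ y \in sub_verts;
  sub_edge_sub : subrel sub_edge (@sedge G)
}.

Definition sub_degree (G : sgraph) (H : subgraph G) (x : G) : nat :=
  #|[set y : G | sub_edge H x y]|.

Definition regular_subgraph (G : sgraph) (r : nat) (H : subgraph G) : Prop :=
  forall x : G, x \in sub_verts H -> sub_degree H x = r.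

(* Main.v *)
Require Import Defs.
From HB Require Import structures.
From mathcomp Require Import all_boot all_order all_algebra.
From mathcomp Require Import reals.
From mathcomp Require Import zify ring lra.
Import Order.TTheory GRing.Theory Num.Theory.

Set Implicit Arguments.
Unset Strict Implicit.
Unset Printing Implicit Defensive.

(* A graph of maximum degree at most 2q - 1 with more than (q - 1)n edges, q a power of
   2, has a non-empty q-regular subgraph (Alon, Friedland and Kalai); if it is bipartite,
   max-flow min-cut then gives an r-regular subgraph for every r <= q. By integrality of
   bipartite b-matchings it suffices to find, in a bipartite subgraph of G, edge
   weights in [0, 1] on a non-empty vertex set, whose weighted degrees are at most
   some D = Omega(d) and fall short of D by O(1) on average.

   Start with a small constant weight. If a vertex v has weighted degree y D, keep v
   with probability y and divide the weights of its edges by y: the surviving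
   vertices then have expected degree D. A mean shortfall of kappa turns into random
   fluctuations of order sqrt kappa, and trimming the overfull vertices makes these the
   new shortfall. After two such rounds the shortfall is a small power of D, and
   further rounds bring it down to O(1). Since weights must not grow by more than a
   constant factor in total, in these further rounds a vertex is kept with
   probability at least 1 - 1/u, where u decreases geometrically, and the
   vertices of exceptionally small degree are controlled separately. *)

(** * Bipartite degree-constrained subgraphs *)

(** Capacity of a cut in the network source -> [A] -> [B] -> sink with capacities [bA], 1 and [bB];
    the source side consists of [S] and [T]. *)
Definition cut (A B : finType) (E : {set A * B}) (bA : A -> nat) (bB : B -> nat)
    (S : {set A}) (T : {set B}) : nat :=
  \sum_a (a \notin S) * bA a + \sum_b (b \in T) * bB b
  + \sum_(e in E) ((e.1 \in S) && (e.2 \notin T)).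

(** True summand by summand: the vertex terms are modular, and an edge term is checked over the
    possible positions of its two ends. *)
Lemma cut_submodular (A B : finType) (E : {set A * B}) bA bB (S1 S2 : {set A}) (T1 T2 :
  {set B}) :
  cut E bA bB (S1 :&: S2) (T1 :&: T2) + cut E bA bB (S1 :|: S2) (T1 :|: T2)
  <= cut E bA bB S1 T1 + cut E bA bB S2 T2.
Proof.
have -> (x1 y1 z1 x2 y2 z2 : nat) :
  x1 + y1 + z1 + (x2 + y2 + z2) = (x1 + x2) + (y1 + y2) + (z1 + z2) by lia.
rewrite [leqRHS]addnACA [X in _ <= X + _]addnACA -!big_split /=.
apply: leq_add; first apply: leq_add.
- apply: leq_sum => a _; rewrite !inE.
  by case: (a \in S1); case: (a \in S2); rewrite /= ?mul1n ?mul0n; lia.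
- apply: leq_sum => b _; rewrite !inE.
  by case: (b \in T1); case: (b \in T2); rewrite /= ?mul1n ?mul0n; lia.
- apply: leq_sum => e _; rewrite !inE.
  by case: (e.1 \in S1); case: (e.1 \in S2); case: (e.2 \in T1); case: (e.2 \in T2).
Qed.

Lemma cut_setD1 (A B : finType) (E : {set A * B}) bA bB (S : {set A}) (T : {set B}) e :
  e \in E ->
  cut E bA bB S T =
  cut (E :\ e) bA bB S T + ((e.1 \in S) && (e.2 \notin T)).
Proof.
by move=> eE; rewrite /cut (big_setD1 e eE) /= -!addnA; congr (_ + (_ + _));
  rewrite addnC.
Qed.

Lemma sum_decr (I : finType) (P : pred I) (b : I -> nat) i0 : 0 < b i0 ->
  \sum_i P i * b i = \sum_i P i * (b i - (i == i0)) + P i0.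
Proof.
move=> b0; rewrite !(bigD1 (P := xpredT) i0) //= eqxx mulnBr muln1.
rewrite (eq_bigr (fun i => P i * (b i - (i == i0)))) => [|i /negbTE->];
  last by rewrite subn0.
by case: (P i0); rewrite ?mul1n ?mul0n; lia.
Qed.

Definition fiber1 (A B : finType) (F : {set A * B}) a := [set e in F | e.1 == a].
Definition fiber2 (A B : finType) (F : {set A * B}) b := [set e in F | e.2 == b].

(** An end of capacity 0 changes sides for free, and this saves the crossing edge [e]. Here and in
    [cut_setU1r] the purpose is that an edge crossing a minimum cut has spare capacity at both
    ends. *)
Lemma cut_setD1l (A B : finType) (E : {set A * B}) bA bB (S : {set A}) (T : {set B}) e :
  e \in E -> e.1 \in S -> e.2 \notin T -> bA e.1 = 0 ->
  cut E bA bB (S :\ e.1) T < cut E bA bB S T.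
Proof.
move=> eE eS eT bA0; rewrite !(cut_setD1 _ _ _ _ eE) /= eS eT !inE eqxx /= addn0 addn1
  ltnS.
apply: leq_add; first apply: leq_add => //.
  apply: leq_sum => a' _; rewrite !inE; case: eqP => [->|//]; by rewrite bA0 muln0.
by apply: leq_sum => e' _; rewrite !inE; case: eqP => //= _; case: (_ \in S).
Qed.

Lemma cut_setU1r (A B : finType) (E : {set A * B}) bA bB (S : {set A}) (T : {set B}) e :
  e \in E -> e.1 \in S -> e.2 \notin T -> bB e.2 = 0 ->
  cut E bA bB S (e.2 |: T) < cut E bA bB S T.
Proof.
move=> eE eS eT bB0; rewrite !(cut_setD1 _ _ _ _ eE) /= eS eT !inE eqxx /= addn0 addn1
  ltnS.
apply: leq_add; first apply: leq_add => //.
  apply: leq_sum => b' _; rewrite !inE; case: eqP => [->|//]; by rewrite bB0 muln0.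
apply: leq_sum => e' _; rewrite !inE; case: eqP => //= _; by rewrite ?andbF //;
  case: (_ && _).
Qed.

(* Max-flow min-cut by induction on the edges: an edge lying on a minimum cut
   [(S1, T1)] can be used, since a cut of the residual instance that is too small
   would have to be crossed backwards by the edge, which contradicts
   submodularity. *)
Lemma cut_matching (A B : finType) (E : {set A * B}) (bA : A -> nat) (bB : B -> nat) k :
  (forall S T, k <= cut E bA bB S T) ->
  exists F : {set A * B}, [/\ F \subset E, k <= #|F|,
    forall a, #|fiber1 F a| <= bA a & forall b, #|fiber2 F b| <= bB b].
Proof.
have [n] := ubnP #|E|; elim: n => // n IH in E bA bB k * => cE le_k.
have [E0|[e0 e0E]] := set_0Vmem E.
  exists set0; split; rewrite ?sub0set //.
  - have := le_k setT set0; rewrite /cut E0 cards0.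
    by rewrite big_set0 !big1 // => i _; rewrite inE.
  - by move=> a; rewrite eq_card0 // => e; rewrite !inE.
  - by move=> b; rewrite eq_card0 // => e; rewrite !inE.
have cE' : #|E :\ e0| < n by move: cE; rewrite [X in X < _](cardsD1 e0) e0E add1n ltnS.
case: (boolP [forall S, forall T, k <= cut (E :\ e0) bA bB S T]).
  move=> /forallP le_k'; have [S T|F [FE kF FA FB]] := IH (E :\ e0) bA bB k cE'.
    exact: (forallP (le_k' S) T).
  by exists F; split=> //; apply: subset_trans FE (subD1set _ _).
(* Deleting [e0] pushes some cut below [k], so [e0] crosses that cut and its capacity was exactly
   [k]. *)
rewrite negb_forall => /existsP[S1]; rewrite negb_forall => /existsP[T1].
rewrite -ltnNge => lt1; have := le_k S1 T1; rewrite (cut_setD1 _ _ _ _ e0E) /=.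
case aS1: (e0.1 \in S1) => //=; last by lia.
case bT1: (e0.2 \in T1) => //=; first by lia.
move=> le1; have {le1}{}lt1 : cut E bA bB S1 T1 = k.
  by rewrite (cut_setD1 _ _ _ _ e0E) /= aS1 bT1 /=; lia.
have bA0 : 0 < bA e0.1.
  rewrite lt0n; apply/eqP => bA0.
  have := cut_setD1l bB e0E aS1 (negbT bT1) bA0.
  by have := le_k (S1 :\ e0.1) T1; lia.
have bB0 : 0 < bB e0.2.
  rewrite lt0n; apply/eqP => bB0.
  have := cut_setU1r bA e0E aS1 (negbT bT1) bB0.
  by have := le_k S1 (e0.2 |: T1); lia.
(* Using [e0] spends one unit at each end. Every cut then drops by 1, or by 2 if [e0] crosses it
   backwards. *)
pose bA' a := bA a - (a == e0.1); pose bB' b := bB b - (b == e0.2).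
have cutE S T : cut E bA bB S T = cut (E :\ e0) bA' bB' S T +
    ((e0.1 \notin S) + (e0.2 \in T) + ((e0.1 \in S) && (e0.2 \notin T))).
  rewrite (cut_setD1 _ _ _ _ e0E) /cut /=.
  rewrite (sum_decr (fun a => a \notin S) bA0) // (sum_decr (fun b => b \in T) bB0) //.
  rewrite /bA' /bB' /=; lia.
have [S T|F [FE kF FA FB]] := IH (E :\ e0) bA' bB' k.-1 cE'.
  have := le_k S T; have := cutE S T.
  case aS: (e0.1 \in S); case bT: (e0.2 \in T) => /=; try lia.
  (* Backward crossing: [e0] crosses neither the intersection nor the union with the minimum cut, so
     each has capacity at least [k] without [e0], while the two given cuts sum to at most [2k - 1]
     without it. *)
  move=> h1 h2; rewrite leqNgt; apply/negP => h3.
  have hI := le_k (S1 :&: S) (T1 :&: T); have hU := le_k (S1 :|: S) (T1 :|: T).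
  have := cut_submodular (E :\ e0) bA bB S1 S T1 T.
  move: hI hU lt1 h1 h2.
  rewrite !(cut_setD1 _ _ _ _ e0E) /= !inE aS1 bT1 aS bT /=; lia.
have e0F : e0 \notin F by apply/negP => /(subsetP FE); rewrite !inE eqxx.
exists (e0 |: F); split.
- by rewrite subUset sub1set e0E; apply: subset_trans FE (subD1set _ _).
- by rewrite cardsU1 e0F; lia.
- move=> a; have := FA a; rewrite /bA'; case: (altP (a =P e0.1)) => [->|ne].
    have -> : fiber1 (e0 |: F) e0.1 = e0 |: fiber1 F e0.1.
      by apply/setP=> e; rewrite !inE; case: eqP => [->|]; rewrite ?eqxx.
    by have := cardsU1 e0 (fiber1 F e0.1); rewrite !inE (negbTE e0F) /=; lia.
  have -> : fiber1 (e0 |: F) a = fiber1 F a.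
    apply/setP=> e; rewrite !inE; case: eqP => [->|//].
    by rewrite eq_sym (negbTE ne) !andbF.
  by rewrite subn0.
- move=> b; have := FB b; rewrite /bB'; case: (altP (b =P e0.2)) => [->|ne].
    have -> : fiber2 (e0 |: F) e0.2 = e0 |: fiber2 F e0.2.
      by apply/setP=> e; rewrite !inE; case: eqP => [->|]; rewrite ?eqxx.
    by have := cardsU1 e0 (fiber2 F e0.2); rewrite !inE (negbTE e0F) /=; lia.
  have -> : fiber2 (e0 |: F) b = fiber2 F b.
    apply/setP=> e; rewrite !inE; case: eqP => [->|//].
    by rewrite eq_sym (negbTE ne) !andbF.
  by rewrite subn0.
Qed.

(** Weak duality: in any cut, the weight of each edge is charged to its end in [A], to its end in
    [B], or to the edge itself, so every cut is at least the total weight. Cuts are integers, hence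
    the strict inequality with [+ 1], which rounds the total up. *)
Lemma fractional_matching (R : realFieldType) (A B : finType) (E : {set A * B})
    (w : A -> B -> R) (bA : A -> nat) (bB : B -> nat) (k : nat) :
  (forall a b, 0 <= w a b <= 1)%R ->
  (forall a b, (a, b) \notin E -> w a b = 0%R) ->
  (forall a, \sum_b w a b <= (bA a)%:R)%R ->
  (forall b, \sum_a w a b <= (bB b)%:R)%R ->
  (k%:R < \sum_a \sum_b w a b + 1)%R ->
  exists F : {set A * B}, [/\ F \subset E, k <= #|F|,
    forall a, #|fiber1 F a| <= bA a & forall b, #|fiber2 F b| <= bB b].
Proof.
move=> w01 wE wA wB wk; apply: cut_matching => S T; rewrite -ltnS -(ltr_nat R).
apply: lt_le_trans wk _; rewrite -addn1 natrD lerD2r /cut !natrD !natr_sum.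
have -> : (\sum_(e in E) ((e.1 \in S) && (e.2 \notin T))%:R =
    \sum_a \sum_b ((a, b) \in E)%:R * ((a \in S) && (b \notin T))%:R :> R)%R.
  rewrite pair_bigA /= big_mkcond /=; apply: eq_bigr => -[a b] _ /=.
  by case: (_ \in E); rewrite ?mul1r ?mul0r.
have wAS : (\sum_a (a \notin S)%:R * \sum_b w a b <=
    \sum_a ((a \notin S) * bA a)%:R)%R.
  by apply: ler_sum => a _; rewrite natrM ler_wpM2l.
have wBT : (\sum_b (b \in T)%:R * \sum_a w a b <= \sum_b ((b \in T) * bB b)%:R)%R.
  by apply: ler_sum => b _; rewrite natrM ler_wpM2l.
apply: le_trans (lerD (lerD wAS wBT) (lexx _)).
under [X in (_ <= X + _ + _)%R]eq_bigr do rewrite mulr_sumr.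
under [X in (_ <= _ + X + _)%R]eq_bigr do rewrite mulr_sumr.
rewrite [X in (_ <= _ + X + _)%R]exchange_big -!big_split /=.
apply: ler_sum => a _; rewrite -!big_split /=; apply: ler_sum => b _.
have /andP[w0 w1] := w01 a b; case: (boolP ((a, b) \in E)) => [_|/wE->].
  by case: (a \in S); case: (b \in T); rewrite /= ?mul1r ?mul0r; lra.
by rewrite !mulr0 mul0r; lra.
Qed.

(** * Subgraphs with degrees divisible by a power of 2 *)

(** From [i * 'C(2 ^ j, i) = 2 ^ j * 'C(2 ^ j - 1, i - 1)]: an odd binomial coefficient would force
    [2 ^ j] to divide [i]. *)
Lemma odd_bin_2X j i : 0 < i < 2 ^ j -> ~~ odd 'C(2 ^ j, i).
Proof.
case/andP=> i0 ij; apply/negP => Codd.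
have dvd : 2 ^ j %| i * 'C(2 ^ j, i).
  case: i i0 {ij Codd} => // i _.
  have := mul_bin_diag (2 ^ j) i => <-; exact: dvdn_mulr.
have : 2 ^ j %| i.
  by rewrite -(@Gauss_dvdl _ _ 'C(2 ^ j, i)) // coprimeXl // coprime2n.
by move/(dvdn_leq i0); rewrite leqNgt ij.
Qed.

(** A case of Lucas's theorem: modulo 2, only the two extreme terms of the Vandermonde convolution
    survive. *)
Lemma odd_bin_mul2X j m : odd 'C(m * 2 ^ j, 2 ^ j) = odd m.
Proof.
have q0 : 0 < 2 ^ j by rewrite expn_gt0.
elim: m => [|m IH]; first by rewrite mul0n bin0n eqn0Ngt q0.
rewrite mulSn addnC -binomial.Vandermonde big_ord_recr /= subnn bin0 muln1 oddD IH.
case qE: (2 ^ j) q0 => [//|q] _.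
rewrite big_ord_recl /= bin0 subn0 -qE binn mul1n oddD /=.
rewrite (big_morph odd oddD (erefl _)) big1 => [|i _]; first by case: (odd m).
rewrite oddM [X in _ && X](negbTE (odd_bin_2X _)) ?andbF //.
by rewrite /bump /= qE; have := ltn_ord i; lia.
Qed.

(** Turns divisibility by [2 ^ k] into [k] parity conditions of degrees [2 ^ j], which the
    polynomial method over the field with two elements can handle. *)
Lemma dvdn_2X_bin k n : (forall j, j < k -> ~~ odd 'C(n, 2 ^ j)) -> 2 ^ k %| n.
Proof.
elim: k => [|k IH] Ck; first exact: dvd1n.
have /dvdnP[m nE] : 2 ^ k %| n by apply: IH => j jk; apply: Ck; rewrite ltnW.
move: (Ck k (ltnSn k)); rewrite nE odd_bin_mul2X expnS => m_even.
by rewrite dvdn_mul // dvdn2.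
Qed.

(* [N] is a sum of at most [d]-fold products of the coordinates of the indicator
   function of [F], i.e. a polynomial of degree at most [d] in these. *)
Definition set_poly (I : finType) (d : nat) (N : {set I} -> nat) :=
  exists2 s : seq {set I}, all (fun T : {set I} => #|T| <= d) s &
    forall F, N F = count (fun T : {set I} => T \subset F) s.

Lemma set_poly_const1 (I : finType) : set_poly 0 (fun _ : {set I} => 1).
Proof. by exists [:: set0] => [|F] /=; rewrite ?cards0 ?sub0set. Qed.

Lemma set_polyM (I : finType) d1 d2 (N1 N2 : {set I} -> nat) :
  set_poly d1 N1 -> set_poly d2 N2 -> set_poly (d1 + d2) (fun F => N1 F * N2 F).
Proof.
move=> [s1 s1d s1N] [s2 s2d s2N].
exists [seq T1 :|: T2 | T1 <- s1, T2 <- s2] => [|F].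
  apply/allP => _ /allpairsP[[T1 T2] /= [T1s T2s ->]].
  apply: leq_trans (leq_card_setU T1 T2) _.
  by apply: leq_add; [exact: (allP s1d) | exact: (allP s2d)].
rewrite s1N s2N; elim: s1 {s1d s1N} => //= T s IH.
rewrite mulnDl IH count_cat count_map; congr (_ + _).
case TF: (T \subset F); rewrite ?mul1n ?mul0n.
  by apply: eq_count => T' /=; rewrite subUset TF.
by apply/esym/eqP; rewrite -leqn0 leqNgt -has_count; apply/hasPn=> T' _ /=;
  rewrite subUset TF.
Qed.

Lemma set_poly_prod (J : Type) (T : finType) (r : seq J) (P : pred J) (d : J -> nat)
    (N : J -> {set T} -> nat) : (forall i, set_poly (d i) (N i)) ->
  set_poly (\sum_(i <- r | P i) d i) (fun F => \prod_(i <- r | P i) N i F).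
Proof.
move=> polyN; elim: r => [|i r [s sd sN]].
  rewrite big_nil; have [s sd sN] := set_poly_const1 T.
  by exists s => // F; rewrite big_nil; exact: sN.
rewrite big_cons; case Pi: (P i); last by exists s => // F; rewrite big_cons Pi.
have [|s' s'd s'N] := set_polyM (polyN i) (N2 :=
  fun F => \prod_(j <- r | P j) N j F) (d2 := \sum_(j <- r | P j) d j).
  by exists s.
by exists s' => // F; rewrite big_cons Pi.
Qed.

(** The binomial coefficient counts the [m]-subsets of [A] inside [F], each a monomial of degree
    [m]; the summand 1 is the empty monomial. *)
Lemma set_poly_bin (I : finType) (A : {set I}) m :
  set_poly m (fun F => 1 + 'C(#|F :&: A|, m)).
Proof.
pose X := [set T : {set I} | T \subset A & #|T| == m].
exists (set0 :: enum X) => [|F] /=.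
  by rewrite cards0; apply/allP => T; rewrite mem_enum inE => /andP[_ /eqP->].
rewrite sub0set -cards_draws -sum1_count big_enum_cond /= -sum1_card.
congr (_ + _); apply: eq_bigl => T; rewrite !inE subsetI.
by case: (T \subset F); case: (T \subset A); rewrite ?andbF ?andbT.
Qed.

(** Toggling an element of [E] outside [T] pairs up the supersets of [T]. Thus a polynomial of
    degree below [#|E|] has even sum over the subsets of [E]. *)
Lemma even_count_supersets (I : finType) (E T : {set I}) : #|T| < #|E| ->
  ~~ odd (\sum_(F in powerset E) (T \subset F)).
Proof.
move=> TE; have [/subsetPn[x xT xE]|] := boolP (~~ (T \subset E)).
  rewrite big1 // => F; rewrite powersetE => FE.
  by rewrite (negbTE (_ : ~~ (T \subset F))) //; apply/subsetPn; exists x => //;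
    apply: contra xE => /(subsetP FE).
rewrite negbK => sTE.
have [x xE xT] : exists2 x, x \in E & x \notin T.
  by apply/subsetPn; apply: contraL TE => /subset_leq_card; rewrite leqNgt.
rewrite (bigID (fun F : {set I} => x \in F)) /=.
suff -> : \sum_(F in powerset E | x \in F) (T \subset F) =
    \sum_(F in powerset E | x \notin F) (T \subset F) by rewrite addnn odd_double.
rewrite (reindex_onto (fun F => x |: F) (fun F => F :\ x)) /=; last first.
  by move=> F /andP[_ xF]; rewrite setD1K.
apply: eq_big => [F|F _].
  rewrite !powersetE setU11 subUset sub1set xE /= andbT; congr (_ && _).
  apply/eqP/idP => [<-|xF]; [by rewrite !inE eqxx | exact: setU1K].
congr nat_of_bool; apply/idP/idP => [/subsetP TF|TF];
  last exact: subset_trans TF (subsetUr _ _).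
apply/subsetP => y yT; have := TF y yT; rewrite !inE => /predU1P[yx|//].
by rewrite -yx yT in xT.
Qed.

(** A Chevalley-Warning argument: [N F] is odd exactly when all the degrees are divisible by
    [2 ^ k], and its degree is below [#|E|], so its sum over the subsets of [E] is even. The empty
    set contributes 1, hence some other subset has odd [N]. *)
Lemma exists_subset_dvd_degrees (I V : finType) (E : {set I}) (S : {set V})
    (inc : V -> {set I}) k :
  #|S| * (2 ^ k).-1 < #|E| ->
  exists F : {set I}, [/\ F \subset E, F != set0 &
    forall v, v \in S -> 2 ^ k %| #|F :&: inc v| ].
Proof.
move=> cE.
pose N (F : {set I}) := \prod_(v in S) \prod_(j < k) (1 + 'C(#|F :&: inc v|, 2 ^ j)).
have [s sd sN] : set_poly (\sum_(v in S) \sum_(j < k) 2 ^ j) N.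
  apply: set_poly_prod => v; apply: set_poly_prod => j; exact: set_poly_bin.
have degE : \sum_(v in S) \sum_(j < k) 2 ^ j = #|S| * (2 ^ k).-1.
  by rewrite sum_nat_const predn_exp mul1n.
have evenN : ~~ odd (\sum_(F in powerset E) N F).
  under eq_bigr do rewrite sN -sum1_count big_mkcond /=.
  rewrite exchange_big /= (big_morph odd oddD (erefl _)) big_seq big1 // => T Ts.
  have -> : \sum_(F in powerset E) (if T \subset F then 1 else 0) =
      \sum_(F in powerset E) (T \subset F) by apply: eq_bigr => F _; case: (T \subset F).
  apply/negbTE/even_count_supersets; apply: leq_ltn_trans cE.
  by rewrite -degE; exact: (allP sd).
have N0 : N set0 = 1.
  rewrite /N big1 // => v _; rewrite big1 // => j _.
  by rewrite set0I cards0 bin0n expn_eq0.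
have [/existsP[F /and3P[FE F0 NF]]|] :=
  boolP [exists F : {set I}, [&& F \subset E, F != set0 & odd (N F)]].
  exists F; split=> // v vS; apply: dvdn_2X_bin => j jk.
  move: NF; rewrite /N (bigD1 v) //= oddM => /andP[+ _].
  by rewrite (bigD1 (Ordinal jk)) //= oddM => /andP[+ _]; rewrite oddD.
rewrite negb_exists => /forallP Nev; case/negP: evenN.
rewrite (bigD1 set0) ?powersetE ?sub0set //= N0 oddD (big_morph odd oddD (erefl _)).
rewrite big1 // => F /andP[FE F0]; apply/negbTE; apply: contra (Nev F) => NF.
by rewrite -powersetE FE F0.
Qed.

Local Open Scope ring_scope.

(** * Independent random vertices *)

Definition expect (R : comPzRingType) (V : finType) (p : V -> R)
    (X : {ffun V -> bool} -> R) : R :=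
  \sum_(f : {ffun V -> bool}) (\prod_v (if f v then p v else 1 - p v)) * X f.

Lemma eq_expect (R : comPzRingType) (V : finType) (p : V -> R) X Y :
  X =1 Y -> expect p X = expect p Y.
Proof. by move=> XY; apply: eq_bigr => f _; rewrite XY. Qed.

Lemma expect_sum (R : comPzRingType) (V I : finType) (p : V -> R) (P : pred I)
    (X : I -> {ffun V -> bool} -> R) :
  expect p (fun f => \sum_(i | P i) X i f) = \sum_(i | P i) expect p (X i).
Proof. by rewrite exchange_big /=; apply: eq_bigr => f _; rewrite mulr_sumr. Qed.

Lemma expectZ (R : comPzRingType) (V : finType) (p : V -> R) c X :
  expect p (fun f => c * X f) = c * expect p X.
Proof. by rewrite [RHS]mulr_sumr; apply: eq_bigr => f _; rewrite mulrCA. Qed.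

Lemma expectD (R : comPzRingType) (V : finType) (p : V -> R) X Y :
  expect p (fun f => X f + Y f) = expect p X + expect p Y.
Proof. by rewrite -big_split; apply: eq_bigr => f _; rewrite mulrDr. Qed.

Lemma expect_prod (R : comPzRingType) (V : finType) (p : V -> R)
    (g : V -> bool -> R) :
  expect p (fun f => \prod_v g v (f v)) =
  \prod_v (p v * g v true + (1 - p v) * g v false).
Proof.
transitivity (\prod_v \sum_b (if b then p v else 1 - p v) * g v b).
  by rewrite bigA_distr_bigA /=; apply: eq_bigr => f _; rewrite -big_split.
by apply: eq_bigr => v _; rewrite big_bool.
Qed.

(** Writes a factor depending on one vertex as a product over all vertices, the form that
    [expect_prod] requires. *)
Lemma prod_at (R : comPzRingType) (V : finType) (v : V) (F : V -> R) :
  \prod_x (if x == v then F x else 1) = F v.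
Proof. by rewrite -big_mkcond big_pred1_eq. Qed.

Lemma expect_cst (R : comPzRingType) (V : finType) (p : V -> R) c :
  expect p (fun _ => c) = c.
Proof.
transitivity (expect p (fun f => c * \prod_v (fun _ _ => 1) v (f v))).
  by apply: eq_expect => f; rewrite big1 ?mulr1.
rewrite expectZ (expect_prod p (fun _ _ => 1)) big1 ?mulr1 // => v _.
by rewrite !mulr1 addrC subrK.
Qed.

Lemma expect_coord (R : comPzRingType) (V : finType) (p : V -> R) v :
  expect p (fun f => (f v)%:R) = p v.
Proof.
pose g x (b : bool) : R := if x == v then b%:R else 1.
transitivity (expect p (fun f => \prod_x g x (f x))); first by apply: eq_expect => f;
  rewrite prod_at.
rewrite expect_prod -[RHS](prod_at v p); apply: eq_bigr => x _; rewrite /g.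
by case: (x == v); rewrite ?mulr1 ?mulr0 ?addr0 // addrC subrK.
Qed.

Lemma expect_coordM (R : comPzRingType) (V : finType) (p : V -> R) u v : u != v ->
  expect p (fun f => (f u)%:R * (1 - (f v)%:R)) = p u * (1 - p v).
Proof.
move=> uv.
pose g x (b : bool) : R := (if x == u then b%:R else 1) *
  (if x == v then 1 - b%:R else 1).
transitivity (expect p (fun f => \prod_x g x (f x))); first by apply: eq_expect => f;
  rewrite big_split /= !prod_at.
rewrite expect_prod.
transitivity (\prod_x ((if x == u then p x else 1) * (if x == v then 1 - p x else 1)));
  last by rewrite big_split /= !prod_at.
apply: eq_bigr => x _; rewrite /g; case: (altP (x =P u)) => [->|_].
  by rewrite (negbTE uv) /=; ring.
by case: (x == v) => /=; ring.
Qed.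

(** The centred factor at [u] is independent of the others unless [t = u], even when [t = v], so
    otherwise the mean vanishes. *)
Lemma expect_coord_cov (R : comPzRingType) (V : finType) (p : V -> R) v u t :
  u != v -> expect p (fun f => (f v)%:R * (((f u)%:R - p u) * ((f t)%:R - p t))) =
  if u == t then p v * (p u * (1 - p u)) else 0.
Proof.
move=> uv.
pose g x (b : bool) : R := (if x == v then b%:R else 1) *
  ((if x == u then b%:R - p x else 1) * (if x == t then b%:R - p x else 1)).
transitivity (expect p (fun f => \prod_x g x (f x))).
  by apply: eq_expect => f; rewrite !big_split /= !prod_at.
rewrite expect_prod /g; case: (altP (u =P t)) => [<-|ut].
  transitivity (\prod_x ((if x == v then p x else 1) * (if x == u then p x *
    (1 - p x) else 1))); last by rewrite big_split /= !prod_at.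
  apply: eq_bigr => x _; case: (altP (x =P u)) => [->|_].
    by rewrite (negbTE uv) /=; ring.
  by case: (x == v) => /=; ring.
by rewrite (bigD1 u) //= eqxx (negbTE uv) (negbTE ut) /=; ring.
Qed.

(** The variance of an independent sum, on the event that [v] survives; [c v = 0] keeps the sum
    independent of that event. *)
Lemma expect_square (R : comPzRingType) (V : finType) (p c : V -> R) v : c v = 0 ->
  expect p (fun f => (f v)%:R * (\sum_u c u * ((f u)%:R - p u)) ^+ 2) =
  p v * \sum_u c u ^+ 2 * (p u * (1 - p u)).
Proof.
move=> cv0.
transitivity (expect p (fun f => \sum_u \sum_t c u * c t *
    ((f v)%:R * (((f u)%:R - p u) * ((f t)%:R - p t))))).
  apply: eq_expect => f; rewrite expr2 big_distrlr /= mulr_sumr; apply: eq_bigr => u _.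
  by rewrite mulr_sumr; apply: eq_bigr => t _; ring.
rewrite expect_sum mulr_sumr; apply: eq_bigr => u _; rewrite expect_sum.
have [->|uv] := eqVneq u v.
  by rewrite big1 => [|t _]; rewrite ?expectZ cv0; ring.
rewrite (bigD1 u) //= big1 => [|t tu].
  by rewrite expectZ expect_coord_cov // eqxx; ring.
by rewrite expectZ expect_coord_cov // eq_sym (negbTE tu) mulr0.
Qed.

Lemma expect_lt_exists (R : realFieldType) (V : finType) (p : V -> R) X Y :
  (forall v, 0 <= p v <= 1) -> expect p X < expect p Y -> exists f, X f < Y f.
Proof.
move=> p01 XY; apply/existsP; apply: contraTT XY;
  rewrite negb_exists -leNgt => /forallP YX.
apply: ler_sum => f _; apply: ler_wpM2l; last by rewrite leNgt YX.
apply: prodr_ge0 => v _.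
by case: (f v); have /andP[] := p01 v; rewrite ?subr_ge0.
Qed.

(** * Nearly regular edge weights *)

Definition wdeg (R : pzRingType) (V : finType) (w : V -> V -> R) v := \sum_u w v u.

(** Multiplying by [m / D] with [M * m <= D] gives edge weights at most 1 and degrees at most [m],
    so the cap [M] decides how large a degree can be reached by rounding. *)
Record weighting (R : numDomainType) (V : finType) (e : rel V) (D M : R)
    (S : {set V}) (w : V -> V -> R) : Prop := Weighting {
  wt_ge0 : forall u v, 0 <= w u v;
  wt_le : forall u v, w u v <= M;
  wt_sym : forall u v, w u v = w v u;
  wt_supp : forall u v, ~~ [&& e u v, u \in S & v \in S] -> w u v = 0;
  wt_deg : forall v, wdeg w v <= D
}.

Definition shortfall (R : realFieldType) (V : finType) (w : V -> V -> R)
    (S : {set V}) (c : R) := \sum_(v in S) Num.max 0 (c - wdeg w v).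

Lemma exchange_sym (R : comPzRingType) (V : finType) (y : V -> V -> R) (b : V -> R) :
  (forall u v, y u v = y v u) ->
  \sum_v \sum_u y v u * b u = \sum_u wdeg y u * b u.
Proof.
move=> ysym; rewrite exchange_big /=; apply: eq_bigr => u _.
by rewrite mulr_suml; apply: eq_bigr => v _; rewrite ysym.
Qed.

(* An overfull vertex [v] scales its edges down by [s v]; the weight its
   neighbours lose is controlled by the excess of [v]. *)
Lemma trim_weights (R : realFieldType) (V : finType) (e : rel V) (D M mu h : R)
    (S : {set V}) (y : V -> V -> R) (m : V -> R) :
  0 < D -> 0 < mu -> 0 < h ->
  (forall u v, 0 <= y u v) -> (forall u v, y u v <= M) ->
  (forall u v, y u v = y v u) ->
  (forall u v, ~~ [&& e u v, u \in S & v \in S] -> y u v = 0) ->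
  (forall v, m v <= D) ->
  exists w, [/\ weighting e D M S w,
    shortfall w S D <=
      \sum_(v in S) ((wdeg y v - m v) ^+ 2 / (2 * mu) + mu / 2 + (D - m v)) &
    shortfall w S (D - h) <=
      \sum_(v in S) ((D - m v) + (wdeg y v - m v) ^+ 2 / h)].
Proof.
move=> D0 mu0 h0 y0 yM ysym ysupp mD.
(* [s v] scales an overfull vertex down to degree [D] exactly and is 1 elsewhere; [ex v] is the
   excess removed. *)
pose X := wdeg y; pose s v := D / Num.max (X v) D; pose ex v := Num.max 0 (X v - D).
have sP v : [/\ 0 <= s v <= 1, s v * X v <= D, D - s v * X v <= Num.max 0 (D - X v),
    X v * (1 - s v) <= ex v & D * (1 - s v) <= ex v].
  rewrite /s /ex; case: (leP (X v) D) => XD.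
    rewrite divff ?gt_eqF // subrr !mulr0 mul1r lexx ler01 XD !le_max lexx orbT.
    by rewrite lexx.
  have X0 : 0 < X v by apply: lt_trans XD.
  have sX : D / X v * X v = D by rewrite divfK ?gt_eqF.
  have s0 : 0 <= D / X v by rewrite divr_ge0 ?ltW.
  have s1 : D / X v <= 1 by rewrite ler_pdivrMr // mul1r ltW.
  rewrite sX s0 s1 !le_max subrr lexx /=; split; rewrite ?lexx //.
    by apply/orP; right; rewrite mulrBr mulr1 [X v * _]mulrC sX.
  apply/orP; right.
  have : 0 <= (X v - D) * (1 - D / X v) by rewrite mulr_ge0 // subr_ge0 // ltW.
  move: sX; set z := D / X v => sX; lra.
have s0 v : 0 <= s v by have [/andP[]] := sP v.
have s1 v : 0 <= 1 - s v by rewrite subr_ge0; have [/andP[]] := sP v.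
clearbody s.
have X_out v : v \notin S -> X v = 0.
  by move=> vS; rewrite /X /wdeg big1 // => u _; rewrite ysupp // (negbTE vS) andbF.
have ex_out v : v \notin S -> ex v = 0.
  by move=> vS; rewrite /ex X_out // sub0r; apply/max_idPl; rewrite oppr_le0 ltW.
pose w u v := y u v * (s u * s v).
(* [t v] is what [v] loses in addition, through the scaling of its neighbours. *)
pose t v := \sum_u y v u * (s v * (1 - s u)).
have wdegE v : wdeg w v = s v * X v - t v.
  rewrite /X /wdeg mulr_sumr -sumrB; apply: eq_bigr => u _; rewrite /w; ring.
have t0 v : 0 <= t v.
  apply: sumr_ge0 => u _; rewrite !mulr_ge0 //.
exists w; split.
- split.
  + by move=> u v; rewrite !mulr_ge0 //.
  + move=> u v; apply: le_trans (yM u v); rewrite ler_piMr //.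
    have [/andP[a b] _ _ _ _] := sP u; have [/andP[c d] _ _ _ _] := sP v.
    by rewrite -[1]mulr1 ler_pM.
  + by move=> u v; rewrite /w ysym [s u * _]mulrC.
  + by move=> u v /ysupp; rewrite /w => ->; rewrite mul0r.
  + move=> v; rewrite wdegE; have [_ sX _ _ _] := sP v; have := t0 v; lra.
- have sum_t : \sum_(v in S) t v <= \sum_(v in S) ex v.
    apply: (@le_trans _ _ (\sum_v \sum_u y v u * (1 - s u))).
      rewrite [leRHS](bigID (mem S)) /= -[leLHS]addr0; apply: lerD.
        apply: ler_sum => v _; apply: ler_sum => u _; apply: ler_wpM2l => //.
        have [/andP[_ ?] _ _ _ _] := sP v; have [/andP[_ ?] _ _ _ _] := sP u.
        by rewrite ler_piMl // subr_ge0.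
      apply: sumr_ge0 => v _; apply: sumr_ge0 => u _; by rewrite mulr_ge0 ?s1.
    rewrite exchange_sym // (bigID (mem S)) /= [X in _ + X]big1 ?addr0; last first.
      by move=> v vS; rewrite [wdeg y v]X_out ?mul0r.
    by apply: ler_sum => v _; have [] := sP v.
  apply: (@le_trans _ _ (\sum_(v in S) (Num.max 0 (D - X v) + ex v))).
    rewrite big_split /=; apply: le_trans (lerD (lexx _) sum_t).
    rewrite -big_split /=; apply: ler_sum => v _; rewrite wdegE ge_max.
    have [_ sX sD _ _] := sP v; have := t0 v => tv.
    have : 0 <= Num.max 0 (D - X v) by rewrite le_max lexx.
    by move=> ?; apply/andP; split; lra.
  apply: ler_sum => v _; rewrite -/(X v).
  (* By the inequality of the means, the absolute deviation is at most a multiple of its square plus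
     [mu / 2]; only second moments are then needed. *)
  have := mD v; have : 0 <= (X v - m v) ^+ 2 / (2 * mu) + mu / 2 - `|X v - m v|.
    rewrite -real_normK ?num_real //; set z := `| _ |.
    have -> : z ^+ 2 / (2 * mu) + mu / 2 - z = (z - mu) ^+ 2 / (2 * mu).
      by field; rewrite gt_eqF.
    by rewrite divr_ge0 ?sqr_ge0 // mulr_ge0 // ltW.
  rewrite /ex; case: (ler0P (X v - m v)) => ?; case: (leP 0 (D - X v)) => ?;
    case: (leP 0 (X v - D)) => ?; lra.
(* For the target [D - h], one half of the slack [h] absorbs the loss [t v] up to
   [D * T v / (2 * h)], the other half the deviation of [X v] from [m v]. The bound is then purely
   quadratic in the deviations. *)
- pose T v := \sum_u y v u * (1 - s u) ^+ 2.
  have DT0 v : 0 <= D * T v.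
    rewrite mulr_ge0 ?(ltW D0) //; apply: sumr_ge0 => u _.
    by rewrite mulr_ge0 ?sqr_ge0.
  have tT v : t v <= h / 2 + D * T v / (2 * h).
    have sX : \sum_u y v u * s v <= D.
      by rewrite -mulr_suml mulrC; have [_ ] := sP v.
    apply: (@le_trans _ _ (\sum_u (y v u * s v * (h / (2 * D))
      + y v u * (D / (2 * h) * (1 - s u) ^+ 2)))).
      apply: ler_sum => u _.
      move: (s1 u); set b := 1 - s u => b0; rewrite -subr_ge0.
      have ab : 0 <= h / (2 * D) + D / (2 * h) * b ^+ 2 - b.
        have -> : h / (2 * D) + D / (2 * h) * b ^+ 2 - b = (h - D * b) ^+ 2 / (2 * D * h).
          by field; rewrite !gt_eqF.
        by rewrite divr_ge0 ?sqr_ge0 // !mulr_ge0 // ltW.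
      have -> : y v u * s v * (h / (2 * D)) + y v u * (D / (2 * h) * b ^+ 2) -
          y v u * (s v * b) = y v u * s v * (h / (2 * D) + D / (2 * h) * b ^+ 2 - b) +
          y v u * (1 - s v) * (D / (2 * h) * b ^+ 2) by ring.
      have Dh0 : 0 <= D / (2 * h) by rewrite divr_ge0 ?mulr_ge0 ?ltW.
      by rewrite addr_ge0 // mulr_ge0 // mulr_ge0 ?s1 ?s0 ?sqr_ge0.
    rewrite big_split /=; apply: lerD.
      rewrite -mulr_suml; apply: le_trans (ler_wpM2r _ sX) _.
        by rewrite divr_ge0 ?mulr_ge0 ?ltW.
      by rewrite le_eqVlt; apply/orP; left; apply/eqP; field; exact: lt0r_neq0.
    rewrite le_eqVlt; apply/orP; left; apply/eqP; rewrite /T mulr_sumr mulr_suml.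
    by apply: eq_bigr => u _; ring.
  (* Double counting moves [(1 - s u) ^+ 2] to the vertex [u] that causes it, where it costs at most
     [ex u ^+ 2]. *)
  have sum_T : \sum_(v in S) D * T v <= \sum_(v in S) (X v - m v) ^+ 2.
    apply: (@le_trans _ _ (\sum_v D * T v)).
      rewrite [leRHS](bigID (mem S)) /= lerDl; exact: sumr_ge0.
    rewrite -mulr_sumr exchange_sym // mulr_sumr (bigID (mem S)) /= [X in _
      + X]big1 ?addr0; last first.
      by move=> v vS; rewrite [wdeg y v]X_out ?mul0r ?mulr0.
    apply: ler_sum => v _; rewrite -/(X v).
    have [/andP[sv0 sv1] _ _ Xex Dex] := sP v.
    apply: (@le_trans _ _ (ex v ^+ 2)).
      have -> : D * (X v * (1 - s v) ^+ 2) = (X v * (1 - s v)) * (D * (1 - s v)) by ring.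
      have X0 : 0 <= X v by apply: sumr_ge0.
      by rewrite expr2 ler_pM // mulr_ge0 ?s1 // ltW.
    rewrite /ex; case: (leP 0 (X v - D)) => XD; last by rewrite expr0n sqr_ge0.
    by have mv := mD v; rewrite lerXn2r ?nnegrE //; lra.
  apply: (@le_trans _ _ (\sum_(v in S) ((D - m v) + (X v - m v) ^+ 2 / (2 * h)
    + D * T v / (2 * h)))).
    apply: ler_sum => v _; rewrite wdegE.
    have T0 : 0 <= D * T v / (2 * h) by rewrite divr_ge0 // mulr_ge0 // ltW.
    have z0 : 0 <= (X v - m v) ^+ 2 / (2 * h) by rewrite divr_ge0 ?sqr_ge0 ?mulr_ge0 ?ltW.
    have z1 : 0 <= (X v - m v) ^+ 2 / (2 * h) + h / 2 - (m v - X v).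
      have -> : (X v - m v) ^+ 2 / (2 * h) + h / 2 - (m v - X v) = (X v - m v
        + h) ^+ 2 / (2 * h).
        by field; rewrite gt_eqF.
      by rewrite divr_ge0 ?sqr_ge0 ?mulr_ge0 ?ltW.
    have := mD v; have := tT v; have [_ _ + _ _] := sP v.
    rewrite ge_max; case: (leP 0 (D - X v)) => *; apply/andP; split; lra.
  rewrite !big_split /= -!mulr_suml -addrA lerD2l.
  have hV : 0 <= (2 * h)^-1 by rewrite invr_ge0 mulr_ge0 // ltW.
  apply: le_trans (lerD (lexx _) (ler_wpM2r hV sum_T)) _.
  rewrite le_eqVlt; apply/orP; left; apply/eqP; field; exact: lt0r_neq0.
Qed.

(* A vertex [v] survives with probability [p v], proportional to its weighted
   degree unless this is below [pi * D], and the weights of its edges are divided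
   by [p v]. Then the mean degree of a survivor is [D], except for the vertices
   with degree below [pi * D], and the fluctuations only come from the vertices with
   [p v < 1], so their variance is controlled by the old shortfall. *)
Lemma random_selection (R : realFieldType) (V : finType) (e : rel V)
    (D M pi kap tau mu h : R) (S : {set V}) (w : V -> V -> R) :
  irreflexive e -> 0 < D -> 0 < M -> 0 < pi <= 1 -> 0 < kap -> 0 <= tau ->
  0 < mu -> 0 < h -> S != set0 -> weighting e D M S w ->
  shortfall w S D <= kap * #|S|%:R -> shortfall w S (pi * D) <= tau * #|S|%:R ->
  exists S' w', [/\ S' != set0, weighting e D (M / pi ^+ 2) S' w',
    shortfall w' S' D <=
      3 / pi * (tau + M / pi ^+ 2 * kap / (2 * mu) + mu / 2) * #|S'|%:R &
    shortfall w' S' (D - h) <=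
      3 / pi * (tau + M / pi ^+ 2 * kap / h) * #|S'|%:R].
Proof.
move=> eirr D0 M0 /andP[pi0 pi1] kap0 tau0 mu0 h0 S0 [w0 wM wsym wsupp wD] w_kap w_tau.
pose p v := Num.max (wdeg w v / D) pi.
have p_pi v : pi <= p v by rewrite le_max lexx orbT.
have p0 v : 0 < p v by apply: lt_le_trans pi0 (p_pi v).
have p1 v : p v <= 1 by rewrite ge_max pi1 ler_pdivrMr // mul1r wD.
pose c v u := w v u / (p v * p u).
have c0 v u : 0 <= c v u by rewrite divr_ge0 // mulr_ge0 ?ltW.
pose Z v (f : {ffun V -> bool}) := \sum_u c v u * ((f u)%:R - p u).
(* The degree that a surviving [v] has on average; [Z v f] is the deviation from it. *)
pose m v := wdeg w v / p v.
have mD v : m v <= D.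
  by rewrite ler_pdivrMr // mulrC -ler_pdivrMr // le_max lexx.
pose K (f : {ffun V -> bool}) : {set V} := [set v in S | f v].
have sumK F f : \sum_(v in K f) F v = \sum_(v in S) (f v)%:R * F v.
  rewrite big_mkcond [RHS]big_mkcond /=; apply: eq_bigr => v _; rewrite inE.
  by case: (v \in S); case: (f v); rewrite ?mul1r ?mul0r.
pose a := tau + M / pi ^+ 2 * kap / (2 * mu) + mu / 2.
pose b := tau + M / pi ^+ 2 * kap / h.
have Mpi0 : 0 < M / pi ^+ 2 by rewrite divr_gt0 ?exprn_gt0.
have a0 : 0 < a by rewrite ltr_wpDl ?divr_gt0 // addr_ge0 // ltW // !(mulr_gt0, invr_gt0).
have b0 : 0 < b by rewrite ltr_wpDl // !(mulr_gt0, invr_gt0).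
pose loss1 v (f : {ffun V -> bool}) :=
  (f v)%:R * (Z v f ^+ 2 / (2 * mu) + mu / 2 + (D - m v)).
pose loss2 v (f : {ffun V -> bool}) := (f v)%:R * ((D - m v) + Z v f ^+ 2 / h).
have key f : exists w', [/\ weighting e D (M / pi ^+ 2) (K f) w',
    shortfall w' (K f) D <= \sum_(v in S) loss1 v f &
    shortfall w' (K f) (D - h) <= \sum_(v in S) loss2 v f].
  pose y v u := c v u * ((f v)%:R * (f u)%:R).
  have y0 u v : 0 <= y u v by rewrite mulr_ge0 // mulr_ge0.
  have yM u v : y u v <= M / pi ^+ 2.
    have yc : y u v <= c u v by apply: ler_piMr => //; case: (f u); case: (f v);
      rewrite /= ?mul1r ?mul0r.
    apply: le_trans yc _; apply: ler_pM => //.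
      by rewrite invr_ge0 mulr_ge0 ?ltW.
    by rewrite lef_pV2 ?posrE ?exprn_gt0 ?mulr_gt0 // expr2 ler_pM // ltW.
  have ysym u v : y u v = y v u by rewrite /y /c wsym [p u * _]mulrC [(f u)%:R * _]mulrC.
  have ysupp u v : ~~ [&& e u v, u \in K f & v \in K f] -> y u v = 0.
    rewrite /y /c !inE; case: (f u); case: (f v); rewrite ?mulr0 ?mul0r ?mulr0 //.
    by rewrite !andbT => /wsupp->; rewrite !mul0r.
  have ydev v : v \in K f -> wdeg y v - m v = Z v f.
    rewrite inE => /andP[vS fv]; rewrite /Z /m /wdeg mulr_suml -sumrB.
    apply: eq_bigr => u _; rewrite /y /c fv mul1r; field; rewrite !gt_eqF //.
  have [w' [w'P s1 s2]] := trim_weights D0 mu0 h0 y0 yM ysym ysupp mD.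
  exists w'; split=> //.
    apply: le_trans s1 _; rewrite /loss1 -sumK.
    by apply: ler_sum => v vK; rewrite ydev.
  apply: le_trans s2 _; rewrite /loss2 -sumK.
  by apply: ler_sum => v vK; rewrite ydev.
have EZ v : expect p (fun f => (f v)%:R * Z v f ^+ 2) <=
    M / pi ^+ 2 * \sum_u w v u * (1 - p u).
  rewrite expect_square; last by rewrite /c wsupp ?eirr // mul0r.
  rewrite !mulr_sumr; apply: ler_sum => u _.
  have -> : p v * (c v u ^+ 2 * (p u * (1 - p u))) = c v u * (w v u * (1 - p u)).
    by rewrite /c; field; rewrite !gt_eqF.
  apply: ler_wpM2r; first by rewrite mulr_ge0 // subr_ge0.
  apply: ler_pM => //; first by rewrite invr_ge0 mulr_ge0 ?ltW.
  by rewrite lef_pV2 ?posrE ?exprn_gt0 ?mulr_gt0 // expr2 ler_pM // ltW.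
(* After double counting, the variance is governed by [wdeg w u * (1 - p u)], which is at most
   [D - wdeg w u]: the old shortfall at [u]. *)
have sumEZ : \sum_(v in S) expect p (fun f => (f v)%:R * Z v f ^+ 2) <=
    M / pi ^+ 2 * kap * #|S|%:R.
  apply: le_trans (ler_sum _ (fun v _ => EZ v)) _.
  rewrite -mulr_sumr -mulrA; apply: ler_wpM2l; first exact: ltW.
  apply: le_trans w_kap.
  apply: (@le_trans _ _ (\sum_v \sum_u w v u * (1 - p u))).
    rewrite [leRHS](bigID (mem S)) /= lerDl; apply: sumr_ge0 => v _.
    by apply: sumr_ge0 => u _; rewrite mulr_ge0 // subr_ge0.
  rewrite exchange_sym // (bigID (mem S)) /= [X in _ + X]big1 ?addr0 => [|v vS];
    last first.
    by rewrite /wdeg big1 ?mul0r // => u _; rewrite wsupp // (negbTE vS) andbF.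
  apply: ler_sum => v _; rewrite le_max; apply/orP; right.
  have pv : wdeg w v / D <= p v by rewrite le_max lexx.
  have := wD v; have := p1 v; move: pv; rewrite ler_pdivrMr // => pv p1v wDv.
  have wv0 : 0 <= wdeg w v by apply: sumr_ge0.
  apply: (@le_trans _ _ (D * (1 - p v))); last lra.
  by apply: ler_wpM2r => //; rewrite subr_ge0.
(* Survival with probability [p v] cancels the division by [p v], leaving exactly the shortfall
   below [pi * D]. *)
have Em v : expect p (fun f => (f v)%:R * (D - m v)) = Num.max 0 (pi * D - wdeg w v).
  rewrite (_ : expect _ _ = expect p (fun f => (D - m v) * (f v)%:R)); last first.
    by apply: eq_expect => f; rewrite mulrC.
  rewrite expectZ expect_coord mulrBl /m divfK ?gt_eqF //.
  rewrite /p; case: (leP (wdeg w v / D) pi) => wv.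
    rewrite mulrC; apply/esym/max_idPr; move: wv; rewrite ler_pdivrMr //; lra.
  rewrite mulrCA divff ?gt_eqF // mulr1 subrr; apply/esym/max_idPl.
  by move: wv; rewrite ltr_pdivlMr //; lra.
have E1 : expect p (fun f => \sum_(v in S) loss1 v f) <= a * #|S|%:R.
  rewrite expect_sum.
  apply: (@le_trans _ _ (\sum_(v in S) (expect p (fun f =>
    (f v)%:R * Z v f ^+ 2) / (2 * mu)
     + mu / 2 + Num.max 0 (pi * D - wdeg w v)))).
    apply: ler_sum => v _; rewrite -Em.
    rewrite (_ : expect p (loss1 v) = expect p (fun f =>
      (2 * mu)^-1 * ((f v)%:R * Z v f ^+ 2) +
       (mu / 2 * (f v)%:R + (f v)%:R * (D - m v)))).
      rewrite !expectD !expectZ expect_coord addrA [_^-1 * _]mulrC.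
      by rewrite lerD2r lerD2l ler_piMr // divr_ge0 // ltW.
    by apply: eq_expect => f; rewrite /loss1; ring.
  rewrite !big_split /= -mulr_suml sumr_const -[mu / 2 *+ _]mulr_natr.
  have mu2 : 0 <= (2 * mu)^-1 by rewrite invr_ge0 mulr_ge0 // ltW.
  have := ler_wpM2r mu2 sumEZ.
  by move: w_tau; rewrite /shortfall /a; lra.
have E2 : expect p (fun f => \sum_(v in S) loss2 v f) <= b * #|S|%:R.
  rewrite expect_sum.
  apply: (@le_trans _ _ (\sum_(v in S) (expect p (fun f => (f v)%:R * Z v f ^+ 2) / h
     + Num.max 0 (pi * D - wdeg w v)))).
    apply: ler_sum => v _; rewrite -Em.
    rewrite (_ : expect p (loss2 v) = expect p (fun f => h^-1 * ((f v)%:R * Z v f ^+ 2) +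
       (f v)%:R * (D - m v))).
      by rewrite expectD expectZ [_^-1 * _]mulrC.
    by apply: eq_expect => f; rewrite /loss2; ring.
  rewrite !big_split /= -mulr_suml.
  have hV : 0 <= h^-1 by rewrite invr_ge0 ltW.
  have := ler_wpM2r hV sumEZ.
  by move: w_tau; rewrite /shortfall /b; lra.
have cS : 0 < #|S|%:R :> R by rewrite ltr0n card_gt0.
have ES : pi * #|S|%:R <= expect p (fun f => #|K f|%:R).
  rewrite (_ : expect p _ = expect p (fun f => \sum_(v in S) (f v)%:R)).
    rewrite expect_sum mulr_natr -sumr_const; apply: ler_sum => v _.
    by rewrite expect_coord.
  apply: eq_expect => f; rewrite -sum1_card natr_sum sumK.
  by apply: eq_bigr => v _; rewrite mulr1.
(* One outcome must serve both bounds: normalised by [a] and [b], the two losses have total mean at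
   most [2 * #|S|], strictly less than [3 * #|S|], which is at most [3 / pi] times the mean number
   of survivors. Strictness also gives a survivor. *)
have [||f] := @expect_lt_exists R V p (fun f =>
  a^-1 * \sum_(v in S) loss1 v f + b^-1 * \sum_(v in S) loss2 v f)
   (fun f => 3 / pi * #|K f|%:R).
- by move=> v; rewrite p1 ltW.
- rewrite expectD !expectZ.
  have h1 : a^-1 * expect p (fun f =>
    \sum_(v in S) loss1 v f) <= #|S|%:R by rewrite mulrC ler_pdivrMr // mulrC.
  have h2 : b^-1 * expect p (fun f =>
    \sum_(v in S) loss2 v f) <= #|S|%:R by rewrite mulrC ler_pdivrMr // mulrC.
  apply: (@lt_le_trans _ _ (3 * #|S|%:R)); first lra.
  by rewrite -mulrA ler_wpM2l // mulrC ler_pdivlMr // mulrC.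
move=> fP; have [w' [w'P s1 s2]] := key f; exists (K f), w'.
have sh0 T x : 0 <= shortfall w' T x by apply: sumr_ge0 => v _; rewrite le_max lexx.
have l1 : 0 <= \sum_(v in S) loss1 v f by apply: le_trans s1.
have l2 : 0 <= \sum_(v in S) loss2 v f by apply: le_trans s2.
have l1' : 0 <= a^-1 * \sum_(v in S) loss1 v f by rewrite mulr_ge0 // invr_ge0 ltW.
have l2' : 0 <= b^-1 * \sum_(v in S) loss2 v f by rewrite mulr_ge0 // invr_ge0 ltW.
split=> //.
- apply: contraTneq fP => ->; rewrite cards0 mulr0 -leNgt; exact: addr_ge0.
- apply: le_trans s1 _; rewrite -/a mulrAC -ler_pdivrMr // mulrC; lra.
- apply: le_trans s2 _; rewrite -/b mulrAC -ler_pdivrMr // mulrC; lra.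
Qed.

(** * Successive rounds of selection *)

Lemma weighting_le (R : realFieldType) (V : finType) (e : rel V) (D M M' : R)
    (S : {set V}) (w : V -> V -> R) :
  M <= M' -> weighting e D M S w -> weighting e D M' S w.
Proof. by move=> MM' [? wM *]; split=> // u v; apply: le_trans (wM u v) MM'. Qed.

Lemma shortfall_eq0 (R : realFieldType) (V : finType) (w : V -> V -> R)
    (S : {set V}) (c : R) :
  (forall v, v \in S -> c <= wdeg w v) -> shortfall w S c = 0.
Proof.
move=> cw; apply: big1 => v vS; apply/max_idPl; rewrite subr_le0; exact: cw.
Qed.

(** Take an inclusion-minimal non-empty set with mean internal degree at least [D - kap]: deleting a
    vertex of degree below half of this would preserve the bound. *)
Lemma min_degree_core (R : realFieldType) (V : finType) (e : rel V)
    (D M kap : R) (S : {set V}) (w : V -> V -> R) :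
  0 <= kap < D -> S != set0 -> weighting e D M S w ->
  shortfall w S D <= kap * #|S|%:R ->
  exists S' w', [/\ S' != set0, weighting e D M S' w',
    shortfall w' S' D <= kap * #|S'|%:R &
    forall v, v \in S' -> (D - kap) / 2 <= wdeg w' v].
Proof.
move=> /andP[kap0 kapD] S0 [w0 wM wsym wsupp wD] wS.
pose din (T : {set V}) v := \sum_(u in T) w v u.
pose P (T : {set V}) := (T != set0) && ((D - kap) * #|T|%:R <= \sum_(v in T) din T v).
have dinD T v : din T v <= D.
  apply: le_trans (wD v); rewrite /wdeg [leRHS](bigID (mem T)) /= lerDl.
  exact: sumr_ge0.
have PS : P S.
  rewrite /P S0 /= mulrBl -subr_ge0 -lerBlDl sub0r; move: wS.
  have -> : shortfall w S D = D * #|S|%:R - \sum_(v in S) din S v.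
    rewrite mulr_natr -sumr_const -sumrB; apply: eq_bigr => v vS.
    rewrite (_ : din S v = wdeg w v) ?(max_idPr _) ?subr_ge0 //.
    rewrite /wdeg [RHS](bigID (mem S)) /= [X in _ + X]big1 ?addr0 // => u uS.
    by rewrite wsupp // (negbTE uS) !andbF.
  by rewrite opprB; lra.
have [T /minsetP[/andP[T0 PT] minT] TS] := minset_exists PS.
pose w' u v := if (u \in T) && (v \in T) then w u v else 0.
have w'deg v : wdeg w' v = if v \in T then din T v else 0.
  rewrite /wdeg /w'; case: (v \in T) => /=; last by rewrite big1.
  by rewrite -big_mkcond.
exists T, w'; split=> //.
- split.
  + by move=> u v; rewrite /w'; case: ifP.
  + by move=> u v; rewrite /w'; case: ifP => // _; apply: le_trans (wM u v).
  + by move=> u v; rewrite /w' wsym andbC.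
  + move=> u v; rewrite /w'; case: ifP => // _.
    by rewrite andbT => /negbTE euv; rewrite wsupp // euv.
  + move=> v; rewrite w'deg; case: ifP => // _; lra.
- have -> : shortfall w' T D = D * #|T|%:R - \sum_(v in T) din T v.
    rewrite mulr_natr -sumr_const -sumrB; apply: eq_bigr => v vT.
    by rewrite w'deg vT; apply/max_idPr; rewrite subr_ge0.
  by move: PT; lra.
- move=> v vT; rewrite w'deg vT leNgt; apply/negP => vlow.
  have wvv0 : 0 <= w v v by [].
  have dT : din T v = w v v + din (T :\ v) v by rewrite /din (big_setD1 v).
  have ddT : \sum_(u in T) din T u = \sum_(u in T :\ v) din (T :\ v) u
    + din (T :\ v) v + din T v.
    rewrite (big_setD1 v) //= addrC; congr (_ + _).
    rewrite /din [X in _ = _ + X](_ : _ = \sum_(u in T :\ v) w u v);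
      last by apply: eq_bigr.
    by rewrite -big_split /=; apply: eq_bigr => u _; rewrite (big_setD1 v) //= addrC.
  have cT : #|T|%:R = #|T :\ v|%:R + 1 :> R by rewrite (cardsD1 v) vT add1n -natr1.
  have PT' : (D - kap) * #|T :\ v|%:R <= \sum_(u in T :\ v) din (T :\ v) u.
    by move: PT; rewrite ddT cT; lra.
  (* If [v] is alone, its degree would be at least [D - kap], which is positive, against [vlow]. *)
  have [Tv0|Tv0] := eqVneq (T :\ v) set0.
    by move: PT; rewrite ddT cT Tv0 big_set0 cards0 /din big_set0; move: vlow;
      rewrite /din; lra.
  have PTv : P (T :\ v) by rewrite /P Tv0.
  by have := minT _ PTv (subD1set _ _) => /setP/(_ v); rewrite !inE eqxx vT.
Qed.

(* The parameter [u] measures the irregularity: the mean shortfall is of order [u ^ 3].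
   The last condition lets [random_selection] keep every vertex with probability at
   least [1 - 1 / u] in the step from [u] to [u / 2], so that the weights only grow by a
   factor [(1 - 1 / u) ^- 2], and the product of these factors is bounded. *)
Definition almost_regular (R : realFieldType) (V : finType) (e : rel V) (D u : R) :=
  exists S w, [/\ S != set0, weighting e D ((1 - u^-1) ^- 2) S w,
    shortfall w S D <= 100 * u ^+ 3 * #|S|%:R &
    shortfall w S ((1 - u^-1) * D) <= u ^- 3 * #|S|%:R].

(** One selection with [pi = 1 - 1 / u]. The choice [mu = 16 * u ^+ 2] makes the new mean shortfall
    [O(u ^+ 2)], below [100 * (u / 2) ^+ 3]. The slack [h = 2 * D / u] is forced by the new target
    [(1 - 2 / u) * D], and [D >= 200 * u ^+ 7] makes the variance term there at most [u ^- 3]. *)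
Lemma almost_regular_half (R : realFieldType) (V : finType) (e : rel V) (D u : R) :
  irreflexive e -> 4 <= u -> 200 * u ^+ 7 <= D ->
  almost_regular e D u -> almost_regular e D (u / 2).
Proof.
move=> eirr u4 uD [S [w [S0 wP wk wt]]].
have u0 : 0 < u by lra.
have x0 : 0 < u^-1 by rewrite invr_gt0.
have x4 : u^-1 <= 1 / 4 by rewrite mul1r lef_pV2 ?posrE.
have D0 : 0 < D by apply: lt_le_trans uD; rewrite mulr_gt0 // exprn_gt0.
have pi0 : 0 < 1 - u^-1 by lra.
have pi1 : 0 < 1 - u^-1 <= 1 by rewrite pi0; lra.
have [|||||S' [w' [S'0 w'P w'k w't]]] :=
  @random_selection R V e D ((1 - u^-1) ^- 2) (1 - u^-1) (100 * u ^+ 3)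
  (u ^- 3) (16 * u ^+ 2) (2 * D / u) S w eirr D0 _ pi1 _ _ _ _ S0 wP wk wt.
- by rewrite invr_gt0 exprn_gt0.
- by rewrite mulr_gt0 ?exprn_gt0.
- by rewrite invr_ge0 exprn_ge0 // ltW.
- by rewrite mulr_gt0 ?exprn_gt0.
- by rewrite divr_gt0 ?mulr_gt0.
have pi4 : (1 - u^-1) ^- 2 / (1 - u^-1) ^+ 2 <= 4.
  rewrite -invfM -exprD invf_ple ?posrE ?exprn_gt0 //.
  have : (1 - u^-1) ^+ 2 >= 9 / 16 by nra.
  rewrite (exprD _ 2 2); set z := (1 - u^-1) ^+ 2; nra.
have pi3 : 3 / (1 - u^-1) <= 4 by rewrite ler_pdivrMr //; lra.
have cS : 0 <= #|S'|%:R :> R by [].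
set A := (1 - u^-1) ^- 2 / _ in w'P w'k w't pi4.
have A0 : 0 <= A by rewrite divr_ge0 ?invr_ge0 ?exprn_ge0 // ltW.
have scale (r1 r2 : R) : 0 <= r1 -> r1 <= r2 -> 3 / (1 - u^-1) * r1 <= 4 * r2.
  by move=> r10 r12; apply: ler_pM => //; rewrite divr_ge0 // ltW.
have u3 : 0 < u ^- 3 by rewrite invr_gt0 exprn_gt0.
exists S', w'; split=> //.
(* The weight caps telescope because [(1 - 1 / u) ^+ 2 >= 1 - 2 / u]. *)
- apply: weighting_le w'P; rewrite invf_div /A -invfM -exprD.
  rewrite lef_pV2 ?posrE ?exprn_gt0 //; last by lra.
  have le1 : 1 - 2 / u <= (1 - u^-1) ^+ 2 by rewrite expr2; nra.
  by rewrite exprD expr2; apply: ler_pM => //; lra.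
- apply: le_trans w'k _; apply: ler_wpM2r => //.
  have -> : A * (100 * u ^+ 3) / (2 * (16 * u ^+ 2)) = A * (25 / 8 * u).
    by field; rewrite gt_eqF.
  have Au : A * (25 / 8 * u) <= 4 * (25 / 8 * u) by apply: ler_wpM2r => //; lra.
  have Au0 : 0 <= A * (25 / 8 * u) by rewrite mulr_ge0 //; lra.
  have u31 : u ^- 3 <= 1 by rewrite invf_le1 ?exprn_gt0 // exprn_ege1 //; lra.
  have u2 : 0 <= (u - 4) * u by rewrite mulr_ge0; lra.
  have u2' : 0 <= u ^+ 2 by rewrite sqr_ge0.
  have u3' : 0 <= (u - 4) * u ^+ 2 by rewrite mulr_ge0 //; lra.
  apply: (@le_trans _ _ (4 * (1 + 25 / 2 * u + 8 * u ^+ 2))).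
    by apply: scale; lra.
  rewrite expr_div_n; lra.
- rewrite invf_div.
  have <- : D - 2 * D / u = (1 - 2 / u) * D by ring.
  apply: le_trans w't _; apply: ler_wpM2r => //.
  have -> : A * (100 * u ^+ 3) / (2 * D / u) = A * (50 * u ^+ 4 / D).
    by field; rewrite !gt_eqF.
  have uD0 : 0 <= 50 * u ^+ 4 / D by rewrite divr_ge0 ?mulr_ge0 ?exprn_ge0 ?ltW.
  have uD' : 200 * u ^+ 4 / D <= u ^- 3.
    rewrite ler_pdivrMr // [u ^- 3 * D]mulrC ler_pdivlMr ?exprn_gt0 // -mulrA -exprD;
      exact: uD.
  have AuD : A * (50 * u ^+ 4 / D) <= 4 * (50 * u ^+ 4 / D) by apply: ler_wpM2r.
  have AuD0 : 0 <= A * (50 * u ^+ 4 / D) by rewrite mulr_ge0.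
  apply: (@le_trans _ _ (4 * (2 * u ^- 3))); first by apply: scale; lra.
  rewrite le_eqVlt; apply/orP; left; apply/eqP; field; exact: lt0r_neq0.
Qed.

(** Halving stops at [u = 2], where the weight cap is 4 and the mean shortfall at most 800. *)
Lemma almost_regular_pow2 (R : realFieldType) (V : finType) (e : rel V) (D : R) k :
  irreflexive e -> 200 * (2 ^+ k.+1) ^+ 7 <= D ->
  almost_regular e D (2 ^+ k.+1) -> almost_regular e D 2.
Proof.
move=> eirr; elim: k => [_|k IH kD almost]; first by rewrite expr1.
have k2 : 1 <= 2 ^+ k :> R by rewrite exprn_ege1 // ler1n.
have kE : 2 ^+ k.+2 / 2 = 2 ^+ k.+1 :> R by rewrite [2 ^+ k.+2]exprSr mulfK ?pnatr_eq0.
apply: IH.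
  apply: le_trans kD; rewrite ler_pM2l // lerXn2r ?nnegrE ?exprn_ge0 //.
  by rewrite ler_eXn2l ?ltr1n.
by rewrite -kE; apply: almost_regular_half => //; rewrite !exprS; lra.
Qed.

(** Two rounds, each preceded by passing to a core of large minimum degree so that no vertex lies
    below [pi * D]. With [D] of order [u ^+ 10], the mean shortfall goes from a constant fraction of
    [D] to [O(lam * u ^+ 5)] and then to [O(u ^+ 3)]; the weight cap goes from
    [1 / (144 * lam ^+ 2)] to [1 / 9] and then to 1. *)
Lemma almost_regular_start (R : realFieldType) (lam : R) : 1 <= lam ->
  exists2 B : R, (32 * 100) <= B & forall (V : finType) (e : rel V) (D u : R)
      (S : {set V}) (w : V -> V -> R),
    irreflexive e -> B <= u -> u ^+ 10 <= D <= (32 * 32) * u ^+ 10 -> S != set0 ->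
    weighting e D (144 * lam ^+ 2)^-1 S w ->
    shortfall w S D <= D * (1 - (2 * lam)^-1) * #|S|%:R ->
    almost_regular e D u.
Proof.
move=> lam1; exists ((63 * 100) * lam) => [|V e D u S w eirr ulam /andP[uD Du] S0 wP wS].
  by lra.
have u1 : (63 * 100) <= u by lra.
have u0 : 0 < u by lra.
have un n : 0 < u ^+ n by rewrite exprn_gt0.
have D0 : 0 < D by apply: lt_le_trans uD.
have lam0 : 0 < lam by lra.
have lV0 : 0 < (2 * lam)^-1 by rewrite invr_gt0 mulr_gt0.
have lV1 : (2 * lam)^-1 <= 1 / 2 by rewrite mul1r lef_pV2 ?posrE ?mulr_gt0 //; lra.
have kap0 : 0 < D * (1 - (2 * lam)^-1) by rewrite mulr_gt0 //; lra.
have kapD : D * (1 - (2 * lam)^-1) < D.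
  by rewrite mulrBr mulr1 ltrBlDr ltrDl mulr_gt0.
have [|S1 [w1 [S10 w1P w1k w1d]]] := min_degree_core _ S0 wP wS.
  by rewrite ltW.
(* The core has minimum degree [(D - kap) / 2 = D / (4 * lam)]. *)
have pi1 : 0 < (4 * lam)^-1 <= 1.
  by rewrite invr_gt0 mulr_gt0 //= invf_le1 ?mulr_gt0 //; lra.
have w1t : shortfall w1 S1 ((4 * lam)^-1 * D) <= 0 * #|S1|%:R.
  rewrite shortfall_eq0 ?mul0r // => v vS; apply: le_trans (w1d v vS).
  rewrite le_eqVlt; apply/orP; left; apply/eqP; field; exact: lt0r_neq0.
have [|S2 [w2 [S20 w2P w2k _]]] :=
  random_selection eirr D0 _ pi1 kap0 (lexx 0) (un 5) ltr01 S10 w1P w1k w1t.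
  by rewrite invr_gt0 mulr_gt0 ?exprn_gt0.
have ME : (144 * lam ^+ 2)^-1 / (4 * lam)^-1 ^+ 2 = 9^-1 by field; exact: lt0r_neq0.
rewrite {}ME in w2P w2k.
have {}w2k : shortfall w2 S2 D <= (7 * 100) * lam * u ^+ 5 * #|S2|%:R.
  apply: le_trans w2k _; apply: ler_wpM2r => //.
  have -> : 3 / (4 * lam)^-1 = 12 * lam by field; exact: lt0r_neq0.
  have Du5 : D * (1 - (2 * lam)^-1) / u ^+ 5 <= (32 * 32) * u ^+ 5.
    rewrite ler_pdivrMr //; apply: le_trans (ltW kapD) _.
    by have -> : 32 * 32 * u ^+ 5 * u ^+ 5 = 32 * 32 * u ^+ 10 by ring.
  have -> : 12 * lam * (0 + 9^-1 * (D * (1 - (2 * lam)^-1)) / (2 * u ^+ 5) + u ^+ 5 / 2) =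
      lam * (2 / 3 * (D * (1 - (2 * lam)^-1) / u ^+ 5) + 6 * u ^+ 5).
    by field; rewrite !lt0r_neq0.
  have -> : (7 * 100) * lam * u ^+ 5 = lam * ((7 * 100) * u ^+ 5) by ring.
  by rewrite ler_pM2l //; have := un 5; lra.
have kap2D : (7 * 100) * lam * u ^+ 5 <= D / 3.
  rewrite ler_pdivlMr //; apply: le_trans uD.
  have u51 : 1 <= u ^+ 4 by rewrite exprn_ege1 //; lra.
  have -> : u ^+ 10 = u ^+ 5 * (u * u ^+ 4) by rewrite -exprS -exprD.
  have -> : (7 * 100) * lam * u ^+ 5 * 3 = u ^+ 5 * ((21 * 100) * lam * 1) by ring.
  by rewrite ler_pM2l //; apply: ler_pM => //; lra.
have kap20 : 0 < (7 * 100) * lam * u ^+ 5 by rewrite !mulr_gt0.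
have [|S3 [w3 [S30 w3P w3k w3d]]] := min_degree_core _ S20 w2P w2k.
  by rewrite ltW //=; lra.
(* Now the shortfall is at most [D / 3], so the core has minimum degree at least [D / 3]. *)
have pi3 : 0 < (3^-1 : R) <= 1 by rewrite invr_gt0 ltr0n invf_le1 ?ler1n.
have w3t : shortfall w3 S3 (3^-1 * D) <= 0 * #|S3|%:R.
  rewrite shortfall_eq0 ?mul0r // => v vS; apply: le_trans (w3d v vS); lra.
have h0 : 0 < D / u by rewrite divr_gt0.
have [|S4 [w4 [S40 w4P w4k w4t]]] :=
  random_selection eirr D0 _ pi3 kap20 (lexx 0) (un 3) h0 S30 w3P w3k w3t.
  by rewrite invr_gt0.
exists S4, w4; split=> //.
- apply: weighting_le w4P.
  have -> : 9^-1 / (3^-1) ^+ 2 = 1 :> R by field.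
  have x1 : 0 < 1 - u^-1 by rewrite subr_gt0 invf_lt1 //; lra.
  have x2 : 1 - u^-1 <= 1 by rewrite gerBl invr_ge0 ltW.
  by rewrite invf_ge1 ?exprn_gt0 // exprn_ile1 // ltW.
- apply: le_trans w4k _; apply: ler_wpM2r => //.
  have -> : 3 / 3^-1 * (0 + 9^-1 / 3^-1 ^+ 2 * ((7 * 100) * lam * u ^+ 5) /
    (2 * u ^+ 3) + u ^+ 3 / 2) =
     u ^+ 2 * ((63 * 50) * lam) + 9 / 2 * u ^+ 3 by field; exact: lt0r_neq0.
  have : u ^+ 2 * ((63 * 50) * lam) <= u ^+ 2 * (u / 2) by rewrite ler_pM2l //; lra.
  have -> : u ^+ 2 * (u / 2) = u ^+ 3 / 2 by ring.
  have := un 3; lra.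
- have -> : (1 - u^-1) * D = D - D / u by ring.
  apply: le_trans w4t _; apply: ler_wpM2r => //.
  have -> : 3 / 3^-1 * (0 + 9^-1 / 3^-1 ^+ 2 * ((7 * 100) * lam * u ^+ 5) / (D / u)) =
     (63 * 100) * lam * u ^+ 6 / D by field; rewrite !lt0r_neq0.
  rewrite ler_pdivrMr // [u ^- 3 * D]mulrC ler_pdivlMr //.
  have -> : (63 * 100) * lam * u ^+ 6 * u ^+ 3 = (63 * 100) * lam * u ^+ 9 by ring.
  apply: le_trans uD; rewrite [u ^+ 10]exprS; apply: ler_wpM2r => //; exact: ltW.
Qed.

(** * Regular subgraphs *)

Lemma card_fiber1 (A B : finType) (F : {set A * B}) : (\sum_a #|fiber1 F a| = #|F|)%N.
Proof.
rewrite -sum1_card (partition_big (fun ab => ab.1) xpredT) //=.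
by apply: eq_bigr => a _; rewrite -sum1_card; apply: eq_bigl => ab; rewrite inE.
Qed.

Lemma card_fiber2 (A B : finType) (F : {set A * B}) : (\sum_b #|fiber2 F b| = #|F|)%N.
Proof.
rewrite -sum1_card (partition_big (fun ab => ab.2) xpredT) //=.
by apply: eq_bigr => b _; rewrite -sum1_card; apply: eq_bigl => ab; rewrite inE.
Qed.

Lemma card_fiber1E (A B : finType) (F : {set A * B}) a :
  #|fiber1 F a| = (\sum_b ((a, b) \in F))%N.
Proof.
rewrite -sum1_card (partition_big (fun ab => ab.2) xpredT) //=.
apply: eq_bigr => b _; rewrite sum1_card.
case: (boolP ((a, b) \in F)) => abF.
  apply: (@eq_card1 _ (a, b)) => -[a' b']; rewrite unfold_in !inE /= xpair_eqE.
  by case: eqP => [->|]; case: eqP => [->|]; rewrite ?abF ?andbF.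
apply: eq_card0 => -[a' b']; rewrite unfold_in !inE /=.
by case: eqP => [->|]; case: eqP => [->|]; rewrite ?andbF ?andbT // (negbTE abF).
Qed.

Lemma card_fiber2E (A B : finType) (F : {set A * B}) b :
  #|fiber2 F b| = (\sum_a ((a, b) \in F))%N.
Proof.
rewrite -sum1_card (partition_big (fun ab => ab.1) xpredT) //=.
apply: eq_bigr => a _; rewrite sum1_card.
case: (boolP ((a, b) \in F)) => abF.
  apply: (@eq_card1 _ (a, b)) => -[a' b']; rewrite unfold_in !inE /= xpair_eqE.
  by case: eqP => [->|]; case: eqP => [->|]; rewrite ?abF ?andbF.
apply: eq_card0 => -[a' b']; rewrite unfold_in !inE /=.
by case: eqP => [->|]; case: eqP => [->|]; rewrite ?andbF ?andbT // (negbTE abF).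
Qed.

Lemma eq_of_leq_sum (I : finType) (x y : I -> nat) :
  (forall i, (x i <= y i)%N) -> (\sum_i y i <= \sum_i x i)%N -> x =1 y.
Proof.
move=> xy le_yx i.
have /leqif_sum xyS j : predT j -> (x j <= y j ?= iff (x j == y j))%N by move=> _;
  apply/leqif_eq.
have [le_xy eq_xy] := xyS; apply/eqP; move: eq_xy.
by rewrite eqn_leq le_xy le_yx => /esym/forallP/(_ i).
Qed.

(** Weight [r / q] on every edge saturates all the capacities; an integral solution of the same
    total must saturate them too. *)
Lemma regular_bipartite_subset (A B : finType) (F : {set A * B}) q r :
  (0 < q)%N -> (r <= q)%N ->
  (forall a, #|fiber1 F a| = 0 \/ #|fiber1 F a| = q)%N ->
  (forall b, #|fiber2 F b| = 0 \/ #|fiber2 F b| = q)%N ->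
  exists F' : {set A * B}, [/\ F' \subset F,
    forall a, #|fiber1 F' a| = (r * (fiber1 F a != set0))%N &
    forall b, #|fiber2 F' b| = (r * (fiber2 F b != set0))%N].
Proof.
move=> q0 rq regA regB.
have q0' : q%:R != 0 :> rat by rewrite pnatr_eq0 -lt0n.
pose x (a : A) (b : B) : rat := r%:R / q%:R * ((a, b) \in F)%:R.
have fibA a : r%:R / q%:R * #|fiber1 F a|%:R = (r * (fiber1 F a != set0))%:R :> rat.
  by rewrite -card_gt0; case: (regA a) => ->; rewrite ?muln0 ?mulr0 // q0 muln1 divfK.
have fibB b : r%:R / q%:R * #|fiber2 F b|%:R = (r * (fiber2 F b != set0))%:R :> rat.
  by rewrite -card_gt0; case: (regB b) => ->; rewrite ?muln0 ?mulr0 // q0 muln1 divfK.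
pose k := (\sum_a r * (fiber1 F a != set0))%N.
have kA : k%:R = r%:R / q%:R * #|F|%:R :> rat.
  by rewrite /k natr_sum -card_fiber1 natr_sum mulr_sumr; apply: eq_bigr => a _;
    rewrite fibA.
have kB : k = (\sum_b r * (fiber2 F b != set0))%N.
  apply/eqP; rewrite -(eqr_nat rat) kA natr_sum -card_fiber2 natr_sum mulr_sumr.
  by apply/eqP; apply: eq_bigr => b _; rewrite fibB.
have xA a : \sum_b x a b = (r * (fiber1 F a != set0))%:R.
  by rewrite -fibA card_fiber1E natr_sum mulr_sumr.
have xB b : \sum_a x a b = (r * (fiber2 F b != set0))%:R.
  by rewrite -fibB card_fiber2E natr_sum mulr_sumr.
have [||||| F' [F'F kF' FA FB]] := @fractional_matching _ A B F x
    (fun a => r * (fiber1 F a != set0))%N (fun b => r * (fiber2 F b != set0))%N k.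
- move=> a b; rewrite /x; case: (_ \in F); rewrite ?mulr0 ?lexx ?ler01 // mulr1.
  by rewrite divr_ge0 //= ler_pdivrMr ?ltr0n // mul1r ler_nat.
- by move=> a b /negbTE abF; rewrite /x abF mulr0.
- by move=> a; rewrite xA.
- by move=> b; rewrite xB.
- by under eq_bigr do rewrite xA; rewrite -natr_sum ltrDl.
exists F'; split=> //; apply: eq_of_leq_sum => //; rewrite ?card_fiber1 ?card_fiber2 //.
by rewrite -kB.
Qed.

(** Scaling by [m / D] with [m = 2q - 1] and rounding gives a bipartite edge set of degrees at most
    [m] with more than [(q - 1) * #|S|] edges. A non-empty subset has all degrees divisible by [q],
    hence equal to 0 or [q]. *)
Lemma regular_of_shortfall (R : realFieldType) (V : finType) (e : rel V)
    (X S : {set V}) (D M kap : R) (w : V -> V -> R) k r :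
  0 < D -> S != set0 ->
  weighting (fun u v => e u v && ((u \in X) != (v \in X))) D M S w ->
  shortfall w S D <= kap * #|S|%:R ->
  M * ((2 ^ k).*2.-1)%:R <= D -> kap * ((2 ^ k).*2.-1)%:R < D -> (r <= 2 ^ k)%N ->
  exists F F' : {set V * V}, [/\ F != set0, F' \subset F,
    forall a b, (a, b) \in F -> [/\ e a b, a \in X & b \notin X],
    forall a, #|fiber1 F' a| = (r * (fiber1 F a != set0))%N &
    forall b, #|fiber2 F' b| = (r * (fiber2 F b != set0))%N].
Proof.
move=> D0 S0 [w0 wM wsym wsupp wD] wS; set q := (2 ^ k)%N; set m := (q.*2.-1)%N.
move=> Mm kapm rq.
have q0 : (0 < q)%N by rewrite expn_gt0.
pose E := [set ab : V * V | [&& e ab.1 ab.2, ab.1 \in X, ab.2 \notin X, ab.1 \in S &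
  ab.2 \in S]].
pose x a b := m%:R / D * (((a \in X) && (b \notin X))%:R * w a b).
have mD0 : 0 <= m%:R / D by rewrite divr_ge0 // ltW.
have x_out a b : (a, b) \notin E -> x a b = 0.
  rewrite inE /= /x; case: (a \in X) (b \in X) (wsupp a b) => [] [] /= ws;
    rewrite ?mul0r ?mulr0 //.
  by rewrite andbT in ws => /ws->; rewrite !mulr0.
have xw a b : x a b <= m%:R / D * w a b.
  by rewrite ler_wpM2l // ler_piMl // lern1 leq_b1.
have x0 a b : 0 <= x a b by rewrite mulr_ge0 // mulr_ge0.
have wdm v : m%:R / D * wdeg w v <= m%:R.
  rewrite mulrAC ler_pdivrMr //; apply: ler_wpM2l; [exact: ler0n | exact: wD].
(* [x] orients each edge from [X] to its complement, while the degree sum counts it twice. *)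
have total : 2 * \sum_a \sum_b x a b = m%:R / D * \sum_(v in S) wdeg w v.
  have -> : \sum_(v in S) wdeg w v = \sum_v \sum_u w v u.
    rewrite [RHS](bigID (mem S)) /= [X in _ = _ + X]big1 ?addr0 // => v vS.
    by rewrite big1 // => u _; rewrite wsupp // (negbTE vS) andbF.
  have -> : \sum_a \sum_b x a b = m%:R / D * \sum_a \sum_b ((a \in X) &&
    (b \notin X))%:R * w a b.
    by rewrite mulr_sumr; apply: eq_bigr => a _; rewrite mulr_sumr.
  rewrite mulrCA; congr (_ * _);
    rewrite mulrDl mul1r [X in _ + X]exchange_big -big_split /=.
  apply: eq_bigr => v _; rewrite -big_split /=; apply: eq_bigr => u _.
  rewrite -(wsym v u) -mulrDl -natrD; move: (wsupp v u).
  case: (v \in X); case: (u \in X) => /= ws; rewrite ?mul1r // ws ?mulr0 //;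
    by rewrite andbF.
have mE : m%:R = 2 * q%:R - 1 :> R.
  by rewrite /m -mul2n -subn1 natrB ?natrM // muln_gt0.
have [||||| F [FE kF FA FB]] := @fractional_matching R V V E x (fun=> m) (fun=> m)
    (q.-1 * #|S|).+1.
- move=> a b; rewrite x0 /=; apply: le_trans (xw a b) _.
  rewrite mulrAC ler_pdivrMr // mul1r mulrC; apply: le_trans Mm.
  exact: ler_wpM2r.
- exact: x_out.
- move=> a; apply: le_trans (wdm a); rewrite mulr_sumr; exact: ler_sum.
- move=> b; apply: le_trans (wdm b); rewrite mulr_sumr; apply: ler_sum => a _.
  by rewrite (wsym b a).
- rewrite -natr1 ltrD2r natrM -(@ltr_pM2l _ 2) // total.
  have -> : \sum_(v in S) wdeg w v = D * #|S|%:R - shortfall w S D.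
    rewrite mulr_natr -sumr_const -sumrB; apply: eq_bigr => v _.
    by rewrite (max_idPr _) ?subr_ge0 // opprB addrCA subrr addr0.
  have cS : 0 < #|S|%:R :> R by rewrite ltr0n card_gt0.
  have -> : q.-1%:R = q%:R - 1 :> R by rewrite -subn1 natrB.
  apply: (@lt_le_trans _ _ (m%:R / D * ((D - kap) * #|S|%:R))); last first.
    by apply: ler_wpM2l => //; lra.
  rewrite mulrA [X in _ < X]mulrA ltr_pM2r //.
  (* As [kap * m < D], the loss is below 1 per vertex: twice the total exceeds
     [(m - 1) * #|S| = 2 * (q - 1) * #|S|]. *)
  have -> : m%:R / D * (D - kap) = m%:R - kap * m%:R / D by field; exact: lt0r_neq0.
  have : kap * m%:R / D < 1 by rewrite ltr_pdivrMr // mul1r.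
  rewrite mE; lra.
pose inc v := [set ab : V * V | (ab.1 == v) || (ab.2 == v)].
have [|F' [F'F F'0 F'q]] := @exists_subset_dvd_degrees _ V F S inc k.
  by rewrite mulnC.
have F'E a b : (a, b) \in F' -> [&& e a b, a \in X, b \notin X, a \in S & b \in S].
  by move=> /(subsetP F'F)/(subsetP FE); rewrite inE.
have mq : (m < q.*2)%N by rewrite /m prednK // double_gt0.
have dvd_le n : (q %| n -> n <= m -> n = 0 \/ n = q)%N.
  case/dvdnP=> c -> cm; have : (c < 2)%N.
    by rewrite -(ltn_pmul2r q0) mul2n; apply: leq_ltn_trans cm mq.
  by case: c {cm} => [|[|//]] _; [left | right; rewrite mul1n].
have regA a : #|fiber1 F' a| = 0%N \/ #|fiber1 F' a| = q.
  have [E0|[[a' b] ab]] := set_0Vmem (fiber1 F' a); first by left; rewrite E0 cards0.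
  move: ab; rewrite inE /= => /andP[/F'E/and5P[_ aX _ aS _] /eqP aa];
    rewrite {a'}aa in aX aS.
  apply: dvd_le; last first.
    apply: leq_trans (FA a); apply: subset_leq_card; apply/subsetP => ab.
    by rewrite !inE => /andP[/(subsetP F'F)-> ->].
  rewrite (_ : fiber1 F' a = F' :&: inc a); first exact: F'q.
  apply/setP => -[a' b']; rewrite !inE /=; case abF: (_ \in F') => //=.
  have /and5P[_ _ bX _ _] := F'E _ _ abF; rewrite orbC.
  by rewrite (negbTE (_ : b' != a)) //; apply: contraNneq bX => ->.
have regB b : #|fiber2 F' b| = 0%N \/ #|fiber2 F' b| = q.
  have [E0|[[a b'] ab]] := set_0Vmem (fiber2 F' b); first by left; rewrite E0 cards0.
  move: ab; rewrite inE /= => /andP[/F'E/and5P[_ _ bX _ bS] /eqP bb];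
    rewrite {b'}bb in bX bS.
  apply: dvd_le; last first.
    apply: leq_trans (FB b); apply: subset_leq_card; apply/subsetP => ab.
    by rewrite !inE => /andP[/(subsetP F'F)-> ->].
  rewrite (_ : fiber2 F' b = F' :&: inc b); first exact: F'q.
  apply/setP => -[a' b']; rewrite !inE /=; case abF: (_ \in F') => //=.
  have /and5P[_ aX _ _ _] := F'E _ _ abF.
  by rewrite (negbTE (_ : a' != b)) //; apply: contraNneq bX => <-.
have [F'' [sF'' degA degB]] := regular_bipartite_subset q0 rq regA regB.
by exists F', F''; split=> // a b /F'E/and5P[].
Qed.

(** * From graphs to weightings and back *)

(** For a uniformly random [X], an ordered edge leaves [X] with probability 1/4; the factor 8
    instead of 4 makes the comparison of means strict. *)
Lemma exists_bipartition (R : realFieldType) (V : finType) (e : rel V) :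
  irreflexive e -> 0 < \sum_v \sum_u (e v u)%:R :> R ->
  exists X : {set V}, \sum_v \sum_u (e v u)%:R <
    8 * \sum_v \sum_u ((v \in X) && (u \notin X))%:R * (e v u)%:R :> R.
Proof.
move=> eirr e0; pose p (_ : V) : R := 2^-1.
have [||f] := @expect_lt_exists R V p (fun=> \sum_v \sum_u (e v u)%:R)
    (fun f => \sum_v \sum_u 8 * (e v u)%:R * ((f v)%:R * (1 - (f u)%:R))).
- by move=> v; rewrite invr_ge0 ler0n invf_le1 ?ler1n.
- rewrite expect_cst expect_sum.
  have -> : \sum_v expect p (fun f =>
    \sum_u 8 * (e v u)%:R * ((f v)%:R * (1 - (f u)%:R))) =
      2 * \sum_v \sum_u (e v u)%:R.
    rewrite mulr_sumr; apply: eq_bigr => v _; rewrite expect_sum mulr_sumr.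
    apply: eq_bigr => u _; rewrite expectZ.
    have [->|vu] := eqVneq v u; first by rewrite eirr !mulr0 mul0r.
    by rewrite expect_coordM // /p; field.
  by rewrite mulr2n mulrDl mul1r ltrDl.
move=> fP; exists [set v | f v]; apply: lt_le_trans fP _; rewrite le_eqVlt; apply/orP;
  left; apply/eqP.
rewrite mulr_sumr; apply: eq_bigr => v _; rewrite mulr_sumr; apply: eq_bigr => u _.
by rewrite !inE; case: (f v); case: (f u) => /=; ring.
Qed.

Lemma exists_pow2_bracket (R : realType) (D : R) n : 1 <= D ->
  exists k, (2 ^+ k) ^+ n.+1 <= D < (2 ^+ k.+1) ^+ n.+1.
Proof.
move=> D1.
have [|k Pk mink] := @ex_minnP (fun k => D < (2 ^+ k.+1) ^+ n.+1).
  exists (Num.bound D).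
  have D_lt : D < (Num.bound D)%:R by apply: archi_boundP; lra.
  apply: lt_trans D_lt _; rewrite -exprM -natrX ltr_nat.
  apply: (@leq_trans (2 ^ Num.bound D)); first exact: ltn_expl.
  by rewrite leq_exp2l // mulnS mulSn; lia.
exists k; rewrite Pk andbT; case: k Pk mink => [_ _|k _ mink]; first by rewrite expr1n.
by rewrite leNgt; apply/negP => /mink; rewrite ltnn.
Qed.

Lemma degreeE (G : sgraph) (x : G) : degree x = (\sum_y sedge x y)%N.
Proof. by rewrite /degree -sum1dep_card big_mkcond; apply: eq_bigr => y _;
  case: sedge. Qed.

(** The vertices are those met by [F]. Each lies on one side of [X], so one fiber of [F'] gives its
    whole degree. *)
Lemma subgraph_of_bipartite (G : sgraph) (X : {set G}) (F F' : {set G * G}) r :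
  F != set0 -> F' \subset F ->
  (forall a b, (a, b) \in F -> [/\ sedge a b, a \in X & b \notin X]) ->
  (forall a, #|fiber1 F' a| = (r * (fiber1 F a != set0))%N) ->
  (forall b, #|fiber2 F' b| = (r * (fiber2 F b != set0))%N) ->
  exists H : subgraph G, regular_subgraph r H.
Proof.
move=> F0 F'F FX degA degB.
pose U := [set v | (fiber1 F v != set0) || (fiber2 F v != set0)].
pose s : rel G := fun u v => ((u, v) \in F') || ((v, u) \in F').
have F_U a b : (a, b) \in F -> a \in U /\ b \in U.
  move=> abF; rewrite !inE; split; apply/orP; [left | right];
  by apply/set0Pn; exists (a, b); rewrite inE abF /= eqxx.
have U0 : U != set0.
  by have /set0Pn[[a b] /F_U[aU _]] := F0; apply/set0Pn; exists a.
have s_sym : symmetric s by move=> u v; rewrite /s orbC.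
have s_U u v : s u v -> u \in U /\ v \in U.
  by case/orP=> /(subsetP F'F)/F_U[].
have s_sub : subrel s (@sedge G).
  by move=> u v /orP[] /(subsetP F'F)/FX[]; rewrite 1?sedge_sym.
exists (Subgraph U0 s_sym s_U s_sub) => x; rewrite /sub_degree /= => xU.
have [xX|xX] := boolP (x \in X).
- have xF : fiber2 F x = set0.
    apply/setP => -[a b]; rewrite !inE /=; apply/negP => /andP[/FX[_ _ bX] /eqP bx].
    by rewrite bx xX in bX.
  move: xU; rewrite inE xF eqxx orbF => xU; have := degA x; rewrite xU muln1 => <-.
  rewrite card_fiber1E -sum1dep_card big_mkcond; apply: eq_bigr => y _ /=.
  rewrite /s; have -> : (y, x) \in F' = false.
    by apply/negP => /(subsetP F'F)/FX[_ _]; rewrite xX.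
  by rewrite orbF; case: (_ \in F').
- have xF : fiber1 F x = set0.
    apply/setP => -[a b]; rewrite !inE /=; apply/negP => /andP[/FX[_ aX _] /eqP ax].
    by rewrite -ax aX in xX.
  move: xU; rewrite inE xF eqxx /= => xU; have := degB x; rewrite xU muln1 => <-.
  rewrite card_fiber2E -sum1dep_card big_mkcond; apply: eq_bigr => y _ /=.
  rewrite /s; have -> : (x, y) \in F' = false.
    by apply/negP => /(subsetP F'F)/FX[_ aX _]; rewrite aX in xX.
  by case: (_ \in F').
Qed.

(** * Choice of constants and conclusion *)

Theorem theorem1p13 (R : realType) (lambda : R) (hlambda : 1 <= lambda) :
  exists2 c : R, 0 < c &
    forall G : sgraph,
      (max_degree G)%:R <= lambda * average_degree R G ->
      forall r : nat, (0 < r)%N -> r%:R <= c * average_degree R G ->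
        exists H : subgraph G, regular_subgraph r H.
Proof.
have l0 : 0 < lambda by lra.
(* Passing to a bipartite subgraph may cost a factor 4, leaving mean weighted degree
   [D / (4 * lambda) = D / (2 * lam)], as [almost_regular_start] expects. *)
have [lam lamE] : exists lam, lam = 2 * lambda by eexists.
have lam1 : 1 <= lam by lra.
have lam0 : 0 < lam by lra.
have [B B_ge startB] := almost_regular_start lam1.
have B1 : 1 <= 2 * B by lra.
have B0 : 0 <= 2 * B by apply: le_trans B1.
(* [D >= K] ensures that the power of 2 just below the tenth root of [D] is at least [B]. *)
have [K KE] : exists K, K = (2 * B) ^+ 10 by eexists.
have BK : 2 * B <= K by rewrite KE exprS ler_peMr ?exprn_ege1.
have K_ge : (32 * 100) <= K by lra.
have K0 : 0 < K by lra.
exists (576 * lambda * K)^-1 => [|G Gmax r r0 rc]; first by rewrite invr_gt0 !mulr_gt0.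
set d := average_degree R G in Gmax rc.
pose M := (144 * lam ^+ 2)^-1.
pose D := d / (576 * lambda).
have rK : r%:R * K <= D.
  have rD : (576 * lambda * K)^-1 * d = D / K by rewrite /D; field; rewrite !lt0r_neq0.
  by move: rc; rewrite rD ler_pdivlMr.
have r1 : 1 <= r%:R :> R by rewrite ler1n.
have D1 : K <= D by apply: le_trans rK; rewrite ler_peMl // ltW.
have D0 : 0 < D by apply: lt_le_trans D1.
have M0 : 0 < M by rewrite invr_gt0 mulr_gt0 ?exprn_gt0.
(* With constant weight [M], the degree bound [lambda * d] becomes exactly [D]. *)
have DE : D = M * lambda * d by rewrite /D /M lamE; field; exact: lt0r_neq0.
have d0 : 0 < d by move: D0; rewrite DE pmulr_rgt0 // mulr_gt0.
pose e : rel G := @sedge G.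
have eirr : irreflexive e by exact: sedge_irrefl.
have n0 : 0 < #|G|%:R :> R by rewrite ltr0n svertex_gt0.
have degE : \sum_(v : G) \sum_(u : G) (e v u)%:R = d * #|G|%:R :> R.
  rewrite /d /average_degree divfK ?gt_eqF // natr_sum.
  by apply: eq_bigr => v _; rewrite degreeE natr_sum.
have [|X crossX] := @exists_bipartition R G e eirr.
  by rewrite degE mulr_gt0.
pose eX : rel G := fun u v => e u v && ((u \in X) != (v \in X)).
have eXirr : irreflexive eX by move=> v; rewrite /eX eqxx andbF.
pose w u v : R := M * (eX u v)%:R.
have eX_sym u v : eX u v = eX v u by rewrite /eX /e sedge_sym eq_sym.
have wP : weighting eX D M setT w.
  split.
  - by move=> u v; rewrite mulr_ge0 // ltW.
  - by move=> u v; rewrite ler_piMr ?(ltW M0) // lern1 leq_b1.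
  - by move=> u v; rewrite /w eX_sym.
  - by move=> u v; rewrite !inE !andbT /w => /negbTE->; rewrite mulr0.
  - move=> v; rewrite DE -mulrA /wdeg -mulr_sumr ler_pM2l //.
    apply: le_trans Gmax; rewrite -natr_sum ler_nat.
    apply: (@leq_trans (degree v)); last exact: (leq_bigmax v).
    by rewrite degreeE; apply: leq_sum => u _; rewrite /eX /e; case: (sedge v u);
      case: (_ != _).
have sum_w : \sum_v wdeg w v = 2 * M * \sum_v \sum_u ((v \in X) && (u \notin X))%:R *
  (e v u)%:R.
  rewrite [2 * M]mulrC -mulrA mulr_natl mulr2n [X in _
    + X]exchange_big -big_split /= mulr_sumr.
  apply: eq_bigr => v _; rewrite -big_split /= mulr_sumr; apply: eq_bigr => u _.
  rewrite /w /eX /e [sedge u v]sedge_sym.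
  by case: (v \in X); case: (u \in X); case: sedge; rewrite /=; ring.
have wS : shortfall w setT D <= D * (1 - (2 * lam)^-1) * #|[set: G]|%:R.
  have -> : shortfall w setT D = D * #|G|%:R - \sum_v wdeg w v.
    have -> : \sum_v wdeg w v = \sum_(v in [set: G]) wdeg w v.
      by apply: eq_bigl => v; rewrite inE.
    rewrite mulr_natr -cardsT -sumr_const -sumrB; apply: eq_bigr => v _.
    by apply/max_idPr; rewrite subr_ge0; apply: wt_deg wP v.
  rewrite cardsT sum_w.
  have -> : D * (1 - (2 * lam)^-1) * #|G|%:R = D * #|G|%:R - M / 4 * (d * #|G|%:R).
    by rewrite /M /D lamE; field; exact: lt0r_neq0.
  rewrite lerD2l lerN2 -degE; move: crossX.
  set a := \sum_v _; set b := \sum_v _ => ab;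
    have : M * a < M * (8 * b) by rewrite ltr_pM2l.

  lra.
(* Take [u = 2 ^+ k]; the ratio [2 ^+ 10] of the two bounds is the factor [32 * 32] in
   [almost_regular_start]. *)
have [|k /andP[kD Dk]] := @exists_pow2_bracket R D 9; first lra.
have ku : B <= 2 ^+ k.
  have : 2 * B < 2 ^+ k.+1.
    by rewrite -(@ltr_pXn2r _ 10) ?nnegrE ?exprn_ge0 // -?KE; exact: le_lt_trans Dk.
  by rewrite exprS; lra.
have [k' kE] : exists k', k = k'.+1.
  case: k ku {kD Dk} => [|k' _]; last by exists k'.
  by rewrite expr0; lra.
have : almost_regular eX D (2 ^+ k).
  apply: (startB _ _ _ _ _ _ eXirr ku _ _ wP wS).
    rewrite kD ltW //; apply: lt_le_trans Dk _.
    have E10 : 2 ^+ 10 = 32 * 32 :> R by ring.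
    by rewrite [2 ^+ k.+1]exprS [leLHS]exprMn E10.
  by have /card_gt0P[v _] := svertex_gt0 G; apply/set0Pn; exists v.
rewrite kE => /(almost_regular_pow2 eXirr)[].
  rewrite -kE; apply: le_trans kD; move: ku; set u := 2 ^+ k => ku.
  have u1 : 200 <= u by lra.
  have u0 : 0 < u by lra.
  have u2 : 1 <= u ^+ 2 by apply: exprn_ege1; lra.
  rewrite (exprD u 3 7) ler_pM2r ?exprn_gt0 // exprS -[leLHS]mulr1.
  by apply: ler_pM => //; lra.
move=> S [w' [S0 w'P w'k _]].
have [j rj jr] : exists2 j, (r <= 2 ^ j)%N & (2 ^ j < r.*2)%N.
  exists (up_log 2 r); first exact: up_logP.
  case: (ltnP 1 r) => [r2|]; last by case: r r0 {rc rK r1} => [|[|]].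
  have /andP[lt_r _] := up_log_bounds (isT : 1 < 2)%N r2.
  have := lt_r; have : (0 < up_log 2 r)%N by rewrite up_log_gt0.
  by case: (up_log 2 r) => // i _; rewrite -mul2n expnS ltn_pmul2l.
have mr : ((2 ^ j).*2.-1)%:R + 1 <= 4 * r%:R :> R.
  rewrite natr1 prednK ?double_gt0 ?expn_gt0 // -natrM ler_nat -(mulnA 2 2) !mul2n.
  by rewrite leq_double ltnW.
have rD : (32 * 100) * r%:R <= D.
  by apply: le_trans rK; rewrite mulrC ler_wpM2l.
have pos : 0 <= r%:R :> R by [].
(* Since [2 * 2 ^ j - 1 < 4 * r], the cap 4 and the mean shortfall 800 are both covered by
   [D >= 3200 * r]. *)
have [||F [F' [F0 F'F FX degA degB]]] := regular_of_shortfall D0 S0 w'P w'k _ _ rj.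
- have -> : (1 - 2^-1) ^- 2 = 4 :> R by field.
  lra.
- have -> : 100 * 2 ^+ 3 = 8 * 100 :> R by ring.
  lra.
exact: subgraph_of_bipartite F0 F'F FX degA degB.
Qed.
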